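(* Let $G$ be a 2-step nilpotent Lie group endowed with a left-invariant hypercomplex structure $\{J_i\}_{i=1,2,3}$ which is not abelian, and let $\Gamma\subset G$ be a discrete subgroup such that $M=\Gamma\backslash G$ is compact. Then $M$, with the induced hypercomplex structure $\{J_i\}_{i=1,2,3}$, admits no (invariant or non-invariant) HKT metric compatible with $\{J_i\}_{i=1,2,3}$.
   Context: A hypercomplex structure on a manifold is a triple of (integrable) complex structures $J_1,J_2,J_3$ with $J_i^2=-I$ for $i=1,2,3$ and $J_1J_2=-J_2J_1=J_3$. A left-invariant hypercomplex structure on a Lie group $G$ with Lie algebra $\mathfrak g$ is one whose $J_i$ are left-invariant; it is called abelian if $[J_iX,J_iY]=[X,Y]$ for all $X,Y\in\mathfrak g$ and $i=1,2,3$. A left-invariant structure on $G$ descends to $\Gamma\backslash G$. A Riemannian metric $g$ is compatible with $\{J_i\}$ (hyper-Hermitian) if it is Hermitian with respect to each $J_i$. A hyper-Hermitian metric $g$ on $(M,\{J_i\})$ is an HKT metric if there is a connection $\nabla$ on $TM$ with torsion $T$ such that $\nabla g=0$, $\nabla J_i=0$ for $i=1,2,3$, and $c(X,Y,Z)=g(X,T(Y,Z))$ is a 3-form (i.e. totally skew-symmetric). Equivalently, $J_1dF_1=J_2dF_2=J_3dF_3$, where $F_i$ is the Kähler form of $(J_i,g)$, $F_i(X,Y)=g(J_iX,Y)$, and $(J_i\beta)(X,Y,Z)=-\beta(J_iX,J_iY,J_iZ)$ for a 3-form $\beta$. *)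

(* Defs.v *)
From HB Require Import structures.
From mathcomp Require Import all_boot all_order all_algebra.
From mathcomp Require Import ring.
From mathcomp Require Import all_classical all_reals all_analysis.
Set Implicit Arguments.
Unset Strict Implicit.
Unset Printing Implicit Defensive.
Import Order.TTheory GRing.Theory Num.Theory.
Import numFieldNormedType.Exports.
Local Open Scope classical_set_scope.
Local Open Scope ring_scope.

(* Meant for open [U].  A function is C^(k+1) iff it is differentiable and all
   its directional derivatives are C^k. *)
Fixpoint Ck (R : realType) (V W : normedModType R) (k : nat) (U : set V)
    (f : V -> W) : Prop :=
  match k with
  | 0%N => forall x, U x -> {for x, continuous f}
  | k'.+1 => (forall x, U x -> differentiable f x) /\
             forall v : V, Ck k' U ('D_v f)
  end.

Definition smooth (R : realType) (V W : normedModType R) (U : set V)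
  (f : V -> W) : Prop := forall k, Ck k U f.

Lemma near_eq_differentiable (R : realType) (V W : normedModType R)
    (f g : V -> W) (x : V) :
  {near x, f =1 g} -> differentiable f x -> differentiable g x.
Proof.
move=> fg /diff_locallyP[dfc df].
have gE : g \o shift x = cst (g x) + 'd f x +o_ 0 id.
  apply/eqaddoP => e e0; move/eqaddoP: df => /(_ _ e0).
  have : \forall y \near 0, f (y + x) = g (y + x).
    have fg' : \forall y \near x, f y = g y by exact: fg.
    by move: fg'; rewrite (near_shift 0 x) subr0.
  apply: filterS2 => y /=; rewrite /shift/= !fctE /= /cst => <-.
  by rewrite (nbhs_singleton fg).
by apply/diff_locallyP; rewrite (diff_unique dfc gE).
Qed.

Section SmoothTheory.
Variables (R : realType) (V : normedModType R) (U : set V).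
Hypothesis openU : open U.

Lemma Ck_ext (W : normedModType R) k (f g : V -> W) :
  (forall x, U x -> f x = g x) -> Ck k U f -> Ck k U g.
Proof.
have near_fg (h1 h2 : V -> W) x : U x -> (forall x, U x -> h1 x = h2 x) ->
    {near x, h1 =1 h2}.
  move=> Ux e; have : nbhs x U by exact: open_nbhs_nbhs.
  by apply: filterS => y /e.
elim: k f g => [|k IHk] f g fg /=.
  move=> fc x Ux; have := fc x Ux.
  rewrite /prop_for /continuous_at -(fg x Ux); apply: cvg_trans.
  exact/near_eq_cvg/near_fg.
move=> [df Df]; split=> [x Ux|v].
  exact: near_eq_differentiable (near_fg _ _ _ Ux fg) (df x Ux).
apply: (IHk ('D_v f)) => // x Ux.
by apply: near_eq_derive; exact: near_fg.
Qed.

Lemma CkS (W : normedModType R) k (f : V -> W) : Ck k.+1 U f -> Ck k U f.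
Proof.
elim: k f => [|k IHk] f [df Df] /=.
  by move=> x Ux; apply: differentiable_continuous; exact: df.
by split=> // v; apply: IHk; exact: Df.
Qed.

Lemma Ck_cst (W : normedModType R) k (a : W) : Ck k U (cst a : V -> W).
Proof.
elim: k a => [|k IHk] a /=; first by move=> x _; exact: cvg_cst.
split=> [x _|v]; first exact: differentiable_cst.
by apply: Ck_ext (IHk 0) => x _; rewrite derive_cst.
Qed.

Lemma CkD (W : normedModType R) k (f g : V -> W) :
  Ck k U f -> Ck k U g -> Ck k U (f + g).
Proof.
elim: k f g => [|k IHk] f g /=.
  by move=> fc gc x Ux; apply: continuousD; [exact: fc|exact: gc].
move=> [df Df] [dg Dg]; split=> [x Ux|v].
  by apply: differentiableD; [exact: df|exact: dg].
apply: Ck_ext (IHk _ _ (Df v) (Dg v)) => x Ux.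
by rewrite deriveD//; apply: diff_derivable; [exact: df|exact: dg].
Qed.

Lemma CkM k (f g : V -> R) : Ck k U f -> Ck k U g -> Ck k U (f * g).
Proof.
elim: k f g => [|k IHk] f g.
  by move=> fc gc x Ux; apply: continuousM; [exact: fc|exact: gc].
move=> cf cg; have [[df Df] [dg Dg]] := (cf, cg); split=> [x Ux|v].
  by apply: differentiableM; [exact: df|exact: dg].
apply: Ck_ext (CkD (IHk _ _ (CkS cf) (Dg v)) (IHk _ _ (CkS cg) (Df v))) => x Ux.
by rewrite deriveM//; apply: diff_derivable; [exact: df|exact: dg].
Qed.

End SmoothTheory.

(* [chart_inv] is the inverse of [chart_fun] on [chart_img]; both functions are
   irrelevant outside [chart_dom] and [chart_img] respectively. *)
Record chart (R : realType) (n : nat) (M : topologicalType) := Chart {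
  chart_dom : set M;
  chart_fun :> M -> 'rV[R]_n;
  chart_inv : 'rV[R]_n -> M }.

Definition chart_img (R : realType) (n : nat) (M : topologicalType)
  (c : chart R n M) : set 'rV[R]_n := c @` chart_dom c.

Definition is_chart (R : realType) (n : nat) (M : topologicalType)
    (c : chart R n M) : Prop :=
  [/\ open (chart_dom c), open (chart_img c),
      forall p, chart_dom c p -> chart_inv c (c p) = p,
      forall p, chart_dom c p -> {for p, continuous c}
    & forall x, chart_img c x -> {for x, continuous (chart_inv c)}].

HB.mixin Record isManifold (R : realType) (n : nat) M of Topological M := {
  atlas : set (chart R n M);
  atlas_chart : forall c, atlas c -> is_chart c;
  atlas_cover : forall p : M, exists2 c, atlas c & chart_dom c p;
  atlas_compat : forall c d, atlas c -> atlas d ->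
    smooth (c @` (chart_dom c `&` chart_dom d)) (d \o chart_inv c);
  manifold_hausdorff : hausdorff_space M;
  manifold_second_countable : second_countable (T := M) }.

#[short(type="manifoldType")]
HB.structure Definition Manifold (R : realType) (n : nat) :=
  {M of Topological M & isManifold R n M}.

Definition smooth_map_on (R : realType) (n m : nat) (M : manifoldType R n)
    (N : manifoldType R m) (V : set M) (F : M -> N) : Prop :=
  (forall p, V p -> {for p, continuous F}) /\
  forall (c : chart R n M) (d : chart R m N), atlas c -> atlas d ->
    smooth (c @` (chart_dom c `&` V `&` F @^-1` chart_dom d))
           (d \o F \o chart_inv c).

Definition smooth_map (R : realType) (n m : nat) (M : manifoldType R n)
  (N : manifoldType R m) (F : M -> N) : Prop := smooth_map_on setT F.

Definition local_diffeo (R : realType) (n : nat) (M N : manifoldType R n)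
    (F : M -> N) : Prop :=
  smooth_map F /\
  forall p : M, exists (U : set M) (V : set N) (s : N -> M),
    [/\ open U /\ open V, U p,
        forall x, U x -> V (F x) /\ s (F x) = x,
        forall y, V y -> U (s y) /\ F (s y) = y
      & smooth_map_on V s].

Definition smooth_fun (R : realType) (n : nat) (M : manifoldType R n) :
    {pred M -> R} :=
  mem [set f : M -> R | forall c : chart R n M, atlas c ->
         smooth (chart_img c) (f \o chart_inv c)].
Arguments smooth_fun {R n} M.

Section SmoothFun.
Variables (R : realType) (n : nat) (M : manifoldType R n).

Lemma smooth_fun_cst (a : R) : (cst a : M -> R) \in smooth_fun M.
Proof.
rewrite inE => c /atlas_chart[_ oc _ _ _] k.
by apply: Ck_ext (Ck_cst oc k a).
Qed.

Lemma smooth_funD (f g : M -> R) :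
  f \in smooth_fun M -> g \in smooth_fun M -> f + g \in smooth_fun M.
Proof.
rewrite !inE => sf sg c ac k; have [_ oc _ _ _] := atlas_chart _ ac.
by apply: Ck_ext (CkD oc (sf c ac k) (sg c ac k)).
Qed.

Lemma smooth_funM (f g : M -> R) :
  f \in smooth_fun M -> g \in smooth_fun M -> f * g \in smooth_fun M.
Proof.
rewrite !inE => sf sg c ac k; have [_ oc _ _ _] := atlas_chart _ ac.
by apply: Ck_ext (CkM oc (sf c ac k) (sg c ac k)).
Qed.

Lemma smooth_funZ : scaler_closed (smooth_fun M : {pred M -> R}).
Proof. by move=> a f sf; exact: smooth_funM (smooth_fun_cst a) sf. Qed.

Lemma smooth_fun_subring : subring_closed (smooth_fun M).
Proof.
split=> [|f g sf sg|]; [exact: smooth_fun_cst| |exact: smooth_funM].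
apply: smooth_funD => //.
by rewrite -mulN1r; exact: smooth_funM (smooth_fun_cst (-1)) sg.
Qed.

HB.instance Definition _ := GRing.isSubringClosed.Build _ (smooth_fun M)
  smooth_fun_subring.
HB.instance Definition _ := GRing.isScaleClosed.Build R (M -> R)
  (smooth_fun M) smooth_funZ.

End SmoothFun.

Record Cinfty (R : realType) (n : nat) (M : manifoldType R n) := SmoothFun {
  Cinfty_fun :> M -> R;
  CinftyP : Cinfty_fun \in smooth_fun M }.

Section CinftyRing.
Variables (R : realType) (n : nat) (M : manifoldType R n).

HB.instance Definition _ := [isSub for @Cinfty_fun R n M].
HB.instance Definition _ := [Choice of Cinfty M by <:].
HB.instance Definition _ := GRing.SubChoice_isSubComPzRing.Build (M -> R)
  (smooth_fun M) (Cinfty M) (@smooth_fun_subring R n M).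
HB.instance Definition _ := [SubZmodule_isSubLmodule of Cinfty M by <:].

End CinftyRing.

(* Vector fields are the R-linear derivations of the algebra of smooth
   functions.  They form a module over [Cinfty M], and smooth tensor fields are
   the [Cinfty M]-multilinear maps on that module. *)
Definition is_derivation (R : realType) (n : nat) (M : manifoldType R n) :
    {pred Cinfty M -> (Cinfty M)^o} :=
  mem [set X : Cinfty M -> (Cinfty M)^o |
    (forall (a : R) (f h : Cinfty M), X (a *: f + h) = a *: X f + X h :> Cinfty M) /\
    (forall f h : Cinfty M, X (f * h) = X f * h + f * X h :> Cinfty M)].
Arguments is_derivation {R n} M.

Section Derivations.
Variables (R : realType) (n : nat) (M : manifoldType R n).

Lemma CinftyZr (a : R) (f h : Cinfty M) : f * (a *: h) = a *: (f * h).
Proof. by apply/val_inj/funext => p /=; exact: mulrCA. Qed.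

Lemma derivation_submod : submod_closed (is_derivation M).
Proof.
have combE (u : Cinfty M) (X Y : Cinfty M -> (Cinfty M)^o) f :
  (u *: X + Y) f = u * X f + Y f :> Cinfty M by [].
have zeroE f : (0 : Cinfty M -> (Cinfty M)^o) f = 0 :> Cinfty M by [].
split.
  rewrite inE; split=> [a f h|f h].
    by rewrite !zeroE scaler0 addr0.
  by rewrite !zeroE mul0r mulr0 addr0.
move=> u X Y; rewrite !inE => -[lX dX] [lY dY]; split=> [a f h|f h].
  by rewrite !combE lX lY mulrDr CinftyZr scalerDr addrACA.
by rewrite !combE dX dY; ring.
Qed.

HB.instance Definition _ := GRing.isSubmodClosed.Build (Cinfty M)
  (Cinfty M -> (Cinfty M)^o) (is_derivation M) derivation_submod.

End Derivations.

Record vfield (R : realType) (n : nat) (M : manifoldType R n) := VField {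
  vfield_fun :> Cinfty M -> Cinfty M;
  vfieldP : vfield_fun \in is_derivation M }.

Section VfieldModule.
Variables (R : realType) (n : nat) (M : manifoldType R n).

HB.instance Definition _ := [isSub of vfield M for
  (@vfield_fun R n M : vfield M -> Cinfty M -> (Cinfty M)^o)].
HB.instance Definition _ := [Choice of vfield M by <:].
HB.instance Definition _ := [SubChoice_isSubLmodule of vfield M by <:].

Fact lie_bracket_subproof (X Y : vfield M) :
  (fun f => X (Y f) - Y (X f) : (Cinfty M)^o) \in is_derivation M.
Proof.
have [/set_mem[lX dX] /set_mem[lY dY]] := (vfieldP X, vfieldP Y).
have XD f h : X (f + h) = X f + X h :> Cinfty M.
  by have := lX 1 f h; rewrite !scale1r.
have YD f h : Y (f + h) = Y f + Y h :> Cinfty M.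
  by have := lY 1 f h; rewrite !scale1r.
rewrite inE; split=> [a f h|f h].
  rewrite lX lY lX lY scalerBr opprD.
  by rewrite addrACA.
rewrite dX dY XD YD !dX !dY.
have -> : forall u v : (Cinfty M)^o, u - v = (u : Cinfty M) - v by [].
ring.
Qed.

Definition lie_bracket (X Y : vfield M) : vfield M :=
  VField (lie_bracket_subproof X Y).

End VfieldModule.

(* [dF (X_p) = Y_(F p)] for every [p]. *)
Definition vf_related (R : realType) (n m : nat) (M : manifoldType R n)
    (N : manifoldType R m) (F : M -> N) (X : vfield M) (Y : vfield N) : Prop :=
  forall (f : Cinfty N) (h : Cinfty M), h = f \o F :> (M -> R) ->
    X h = Y f \o F :> (M -> R).

(* [dF \o J = K \o dF]; meant for local diffeomorphisms F. *)
Definition tensor_related (R : realType) (n m : nat) (M : manifoldType R n)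
    (N : manifoldType R m) (F : M -> N)
    (J : {linear vfield M -> vfield M}) (K : {linear vfield N -> vfield N}) :
    Prop :=
  forall (X : vfield M) (Y : vfield N),
    vf_related F X Y -> vf_related F (J X) (K Y).

Section Hypercomplex.
Variables (R : realType) (n : nat) (M : manifoldType R n).

(* Integrability is the vanishing of the Nijenhuis tensor. *)
Definition complex_structure (J : {linear vfield M -> vfield M}) : Prop :=
  (forall X, J (J X) = - X) /\
  (forall X Y, lie_bracket (J X) (J Y) - J (lie_bracket (J X) Y)
               - J (lie_bracket X (J Y)) - lie_bracket X Y = 0).

(* The indices 0, 1, 2 of ['I_3] stand for 1, 2, 3. *)
Definition hypercomplex (J : 'I_3 -> {linear vfield M -> vfield M}) : Prop :=
  (forall i, complex_structure (J i)) /\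
  (forall X, J 0 (J 1 X) = - J 1 (J 0 X) /\ J 0 (J 1 X) = J 2%R X).

(* The last field says [0 < g_p(X_p, X_p)] whenever [X_p] is nonzero. *)
Record metric := Metric {
  metric_fun :> vfield M -> vfield M -> Cinfty M;
  metricC : forall X Y, metric_fun X Y = metric_fun Y X;
  metric_linear : forall (f : Cinfty M) (X Y Z : vfield M),
    metric_fun (f *: X + Y) Z = f * metric_fun X Z + metric_fun Y Z;
  metric_gt0 : forall (X : vfield M) (p : M), (exists h : Cinfty M, X h p != 0) ->
    0 < metric_fun X X p }.

Definition hyper_hermitian (J : 'I_3 -> {linear vfield M -> vfield M})
    (g : metric) : Prop :=
  forall i X Y, g (J i X) (J i Y) = g X Y.

(* [nabla X Y] is the covariant derivative of Y along X. *)
Definition is_connection (nabla : vfield M -> vfield M -> vfield M) : Prop :=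
  [/\ forall (f : Cinfty M) X Y Z,
        nabla (f *: X + Y) Z = f *: nabla X Z + nabla Y Z,
      forall X Y Z, nabla X (Y + Z) = nabla X Y + nabla X Z
    & forall (f : Cinfty M) X Y, nabla X (f *: Y) = X f *: Y + f *: nabla X Y].

Definition torsion (nabla : vfield M -> vfield M -> vfield M) (X Y : vfield M) :
    vfield M :=
  nabla X Y - nabla Y X - lie_bracket X Y.

Definition totally_skew (c : vfield M -> vfield M -> vfield M -> Cinfty M) :
    Prop :=
  forall X Y Z, c Y X Z = - c X Y Z /\ c X Z Y = - c X Y Z.

Definition HKT (J : 'I_3 -> {linear vfield M -> vfield M}) (g : metric) : Prop :=
  hyper_hermitian J g /\
  exists nabla : vfield M -> vfield M -> vfield M,
    [/\ is_connection nabla,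
        forall X Y Z : vfield M, X (g Y Z) = g (nabla X Y) Z + g Y (nabla X Z),
        forall i X Y, nabla X (J i Y) = J i (nabla X Y)
      & totally_skew (fun X Y Z => g X (torsion nabla Y Z))].

End Hypercomplex.

(* Smoothness of the multiplication is read in the product charts of [G * G],
   with ['rV_(n + n)] as the product of two copies of ['rV_n]. *)
HB.mixin Record isLieGroup (R : realType) (n : nat) G
    of Manifold R n G & Group G := {
  lie_mul_continuous : continuous (fun xy : G * G => (xy.1 * xy.2)%g);
  lie_mul_smooth : forall c d e : chart R n G, atlas c -> atlas d -> atlas e ->
    let mul_chart (v : 'rV[R]_(n + n)) :=
      (chart_inv c (lsubmx v) * chart_inv d (rsubmx v))%g in
    smooth [set v | [/\ chart_img c (lsubmx v), chart_img d (rsubmx v)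
                      & chart_dom e (mul_chart v)]]
           (e \o mul_chart);
  lie_inv_smooth : smooth_map (fun x : G => x^-1%g) }.

#[short(type="lieGroupType")]
HB.structure Definition LieGroup (R : realType) (n : nat) :=
  {G of Manifold R n G & Group G & isLieGroup R n G}.

Section LieGroupNotions.
Variables (R : realType) (n : nat) (G : lieGroupType R n).

(* Nilpotency class exactly 2 *)
Definition two_step_nilpotent : Prop :=
  (forall x y z : G, commute (commg x y) z) /\ (exists x y : G, ~ commute x y).

Definition left_invariant_vf (X : vfield G) : Prop :=
  forall a : G, vf_related (fun x => (a * x)%g) X X.

Definition left_invariant (J : {linear vfield G -> vfield G}) : Prop :=
  forall a : G, tensor_related (fun x => (a * x)%g) J J.

Definition abelian_hypercomplex (J : 'I_3 -> {linear vfield G -> vfield G}) :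
    Prop :=
  forall i (X Y : vfield G), left_invariant_vf X -> left_invariant_vf Y ->
    lie_bracket (J i X) (J i Y) = lie_bracket X Y.

Definition discrete_subgroup (Gamma : set G) : Prop :=
  group_closed (mem Gamma) /\ Gamma `<=` isolated Gamma.

(* [M], with the projection [pi], is the quotient of [G] by the left
   translations by [Gamma]: the fibres of [pi] are the cosets [Gamma x], and
   the smooth structure of [M] is the unique one making [pi] a local
   diffeomorphism. *)
Definition is_left_quotient (Gamma : set G) (M : manifoldType R n)
    (pi : G -> M) : Prop :=
  [/\ forall q, exists x, pi x = q,
      forall x y, pi x = pi y <-> Gamma (y * x^-1)%g
    & local_diffeo pi].

End LieGroupNotions.

(* Main.v *)
From HB Require Import structures.
Require Import Defs.
From mathcomp Require Import all_boot all_order all_algebra.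
From mathcomp Require Import all_classical all_reals all_analysis.
From mathcomp Require Import ring lra.
Set Implicit Arguments.
Unset Strict Implicit.
Unset Printing Implicit Defensive.
Import Order.TTheory GRing.Theory Num.Theory.
Import numFieldNormedType.Exports.
Local Open Scope classical_set_scope.
Local Open Scope ring_scope.

(** Let g be the Lie algebra of left-invariant vector fields on G. Its elements
    descend to M = Gamma \ G, compatibly with brackets and with the J_i, so
    that an HKT metric on M gives functions g(X, Y) on M for X, Y in g. If such
    a metric were invariant, these functions would be constant, and the theorem
    would be a statement about g alone. In general one would average over M;
    here the average is replaced by the following fact, in which no measure
    appears. Call a divergence any finite sum of derivatives X f, with X in g
    and f a smooth function on M. Then no divergence is positive at every point
    of M ([divergence_not_gt0]). Indeed, by compactness X f is uniformly close
    to a difference quotient (f(xa) - f(x)) / t, so a divergence bounded below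
    by a positive number would give a sum of terms F(xa) - F(x), with F bounded
    on G, that is bounded below by a positive number. This is impossible on a
    two-step nilpotent group, because averaging over the powers of the elements
    a makes such sums small ([coboundary_not_ge]).

    For an HKT metric with torsion 3-form c, integrability of J_i and the
    invariance of g and J_i under the connection give, for all X, Y, Z in g and
    each i,
      c(X, Y, Z) = - sum (J_i X)(g(Y, J_i Z)) - sum g([J_i X, J_i Y], Z),
    the sums being over cyclic permutations of X, Y, Z ([torsion_form] and
    [torsion_cyclic]). The first sum is a divergence. Hence, modulo divergences,
      S_i(X, Y, Z) = sum g([J_i X, J_i Y], Z)
    does not depend on i, and g(X, X) is a divergence only if X = 0.

    The rest is algebra ([abelian_of_cyclic]). Write I, J, K for the J_i and fix
    X, Y. Put A = [X, Y] - [IX, IY]. Since g is two-step nilpotent, A is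
    central, and so is IA = [IX, Y] + [X, IY]. For any W the vector
    v = [JA, W] is central together with Iv, Jv, Kv, and comparing S_1 with S_2
    at suitable arguments shows that g(v, v) is a divergence; so v = 0 and JA is
    central. The same argument applies to KA. Then S_i(X, Y, A) reduces to
    g([J_i X, J_i Y], A), and comparing the three values at (X, Y) and at
    (IX, IY) shows that g(A, A) is a divergence; hence A = 0.

    The analytic input is of two kinds. A vector field is a derivation of the
    algebra of smooth functions, and cut-off functions together with Hadamard's
    lemma identify it with a directional derivative in each chart
    ([vfield_derive]). Symmetry of second derivatives then shows that a left-
    and right-invariant field commutes with every left-invariant field, from
    which [[X, Y], Z] = 0 on g is deduced for a two-step nilpotent group
    ([bracket_central]). *)

(** * Calculus of C^k functions *)

Section CkTheory.
Variable R : realType.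

(** [Ck k U f] is a condition at each point of [U] separately, which is what
    allows it to be restricted to subsets and checked locally. *)
Lemma Ck_at (V W : normedModType R) k (U : set V) (f : V -> W) :
  Ck k U f <-> forall x, U x -> Ck k [set x] f.
Proof.
elim: k f => [|k IHk] f /=.
  by split=> [fc x Ux y ->|fc x Ux]; [exact: fc Ux|exact: fc Ux x erefl].
split=> [[df Df] x Ux|fU].
  by split=> [y ->|v]; [exact: df|exact: ((IHk _).1 (Df v) x Ux)].
split=> [x Ux|v]; first by have [df _] := fU x Ux; exact: df.
by apply/IHk => x Ux; have [_ Df] := fU x Ux; exact: Df.
Qed.

Lemma Ck_sub (V W : normedModType R) k (U U' : set V) (f : V -> W) :
  U' `<=` U -> Ck k U f -> Ck k U' f.
Proof. by move=> sU /Ck_at fU; apply/Ck_at => x /sU; exact: fU. Qed.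

Lemma Ck_le (V W : normedModType R) j k (U : set V) (f : V -> W) :
  (j <= k)%N -> Ck k U f -> Ck j U f.
Proof.
move=> /subnK <-; elim: (k - j)%N => // m IHm.
by rewrite addSn => /CkS; exact: IHm.
Qed.

Lemma derive_comp (V V' W : normedModType R) (f : V -> V') (g : V' -> W) x v :
  differentiable f x -> differentiable g (f x) ->
  'D_v (g \o f) x = 'D_('D_v f x) g (f x).
Proof.
move=> df dg; rewrite deriveE; last exact: differentiable_comp.
by rewrite diff_comp //= [RHS]deriveE //; congr (_ _); rewrite deriveE.
Qed.

Lemma Ck_comp_linear (V W W' : normedModType R) k (U : set V) (f : V -> W)
    (L : {linear W -> W'}) :
  open U -> continuous L -> Ck k U f -> Ck k U (L \o f).
Proof.
move=> oU cL; elim: k f => [|k IHk] f /=.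
  by move=> fc x Ux; apply: continuous_comp; [exact: fc|exact: cL].
move=> [df Df]; split=> [x Ux|v].
  by apply: differentiable_comp; [exact: df|exact: linear_differentiable].
apply: Ck_ext (IHk _ (Df v)) => // x Ux.
have dL y : differentiable L y by exact: linear_differentiable.
rewrite [RHS](derive_comp v (df x Ux) (dL _)).
by rewrite [RHS]deriveE ?diff_lin.
Qed.

Lemma Ck_linear (V W : normedModType R) k (U : set V) (L : {linear V -> W}) :
  open U -> continuous L -> Ck k U L.
Proof.
move=> oU cL; case: k => [x _|k]; first exact: cL.
split=> [x _|v]; first exact: linear_differentiable.
apply: Ck_ext (Ck_cst oU k (L v)) => // x _.
by rewrite deriveE ?diff_lin//; exact: linear_differentiable.
Qed.

Lemma Ck_sum (V W : normedModType R) k (U : set V) (I : Type) (r : seq I)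
    (f : I -> V -> W) :
  open U -> (forall i, Ck k U (f i)) -> Ck k U (fun x => \sum_(i <- r) f i x).
Proof.
move=> oU Cf; elim: r => [|i r IHr].
  by apply: Ck_ext (Ck_cst oU k 0) => // x _; rewrite big_nil.
by apply: Ck_ext (CkD oU (Cf i) IHr) => // x _; rewrite big_cons.
Qed.

Definition coord_lin m n (i : 'I_m) (j : 'I_n) (N : 'M[R]_(m, n)) : R := N i j.

Fact coord_lin_is_linear m n i j : linear (@coord_lin m n i j).
Proof. by move=> a x y; rewrite /coord_lin !mxE. Qed.

HB.instance Definition _ m n i j :=
  GRing.isLinear.Build R 'M[R]_(m, n) R _ (@coord_lin m n i j)
   (@coord_lin_is_linear m n i j).

Lemma Ck_coord (V : normedModType R) k (U : set V) m (f : V -> 'rV[R]_m) :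
  open U -> Ck k U f <-> forall j, Ck k U (fun x => f x 0 j).
Proof.
move=> oU; split=> [Cf j|Cf].
  by apply: (Ck_comp_linear (L := coord_lin 0 j) oU _ Cf) => N; exact: coord_continuous.
have Csc j : continuous ( *:%R^~ (delta_mx 0 j) : R -> 'rV[R]_m).
  by move=> x; exact: scalel_continuous.
have sl j : linear ( *:%R^~ (delta_mx 0 j) : R -> 'rV[R]_m).
  by move=> a x y; rewrite scalerDl scalerA.
pose sL j : {linear R -> 'rV[R]_m} :=
  HB.pack ( *:%R^~ (delta_mx 0 j) : R -> 'rV[R]_m)
    (GRing.isLinear.Build _ _ _ _ _ (sl j)).
have Cs := Ck_sum (index_enum 'I_m) oU (fun j => Ck_comp_linear oU (L := sL j) (Csc j) (Cf j)).
by apply: Ck_ext Cs => // x _; rewrite [RHS]row_sum_delta.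
Qed.

Lemma derive_row_sum n (W : normedModType R) (g : 'rV[R]_n -> W) x v :
  differentiable g x ->
  'D_v g x = \sum_j v 0 j *: 'D_(delta_mx 0 j) g x.
Proof.
move=> dg; rewrite deriveE // {1}(row_sum_delta v) linear_sum.
by apply: eq_bigr => j _; rewrite linearZ /= deriveE.
Qed.

(** By induction on [k], from the chain rule: the derivatives of [g \o f] are
    sums of products of derivatives of [f] and of partial derivatives of [g]
    composed with [f]. *)
Lemma Ck_comp_real (V : normedModType R) m k (U : set V) (U' : set 'rV[R]_m)
    (f : V -> 'rV[R]_m) (g : 'rV[R]_m -> R) :
  open U -> open U' -> (forall x, U x -> U' (f x)) ->
  Ck k U f -> Ck k U' g -> Ck k U (g \o f).
Proof.
move=> oU oU' fU; elim: k f g fU => [|k IHk] f g fU Cf Cg.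
  by move=> x Ux; apply: continuous_comp; [exact: Cf|exact/Cg/fU].
have [[df Df] [dg Dg]] := (Cf, Cg); split=> [x Ux|v].
  by apply: differentiable_comp; [exact: df|exact/dg/fU].
have Ct j : Ck k U ((fun x => 'D_v f x 0 j) * ('D_(delta_mx 0 j) g \o f)).
  apply: CkM => //; first by move/Ck_coord: (Df v); exact.
  by apply: IHk => //; [exact: CkS|exact: Dg].
apply: Ck_ext (Ck_sum (index_enum 'I_m) oU Ct) => // x Ux.
rewrite derive_comp; [|exact: df|exact/dg/fU].
by rewrite [RHS]derive_row_sum//; exact/dg/fU.
Qed.

End CkTheory.

(** * Mean value estimates and symmetry of second derivatives *)

Section MeanValue.
Variable R : realType.

Lemma derive_line (V : normedModType R) (F : V -> R) x v (t : R) :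
  differentiable F (t *: v + x) ->
  is_derive t (1:R) (fun s : R => F (s *: v + x)) ('D_v F (t *: v + x)).
Proof.
move=> dF; pose l (s : R) := s *: v + x.
have dl : differentiable l t by [].
have Dl : 'D_1 l t = v.
  rewrite deriveE// (_ : l = *:%R^~ v + cst x)// diff_val.
  by rewrite [LHS]/= addr0 scale1r.
apply: DeriveDef; first exact/derivable1_diffP/(differentiable_comp dl dF).
by rewrite (derive_comp _ dl dF) Dl.
Qed.

Lemma mvt_line (V : normedModType R) (F : V -> R) x v :
  (forall t, 0 <= t <= 1 -> differentiable F (t *: v + x)) ->
  exists2 t, 0 <= t <= 1 & F (v + x) - F x = 'D_v F (t *: v + x).
Proof.
move=> dF.
have [||t t01] := @MVT R (fun s => F (s *: v + x)) (fun t => 'D_v F (t *: v + x)) 0 1 ltr01.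
- by move=> t; rewrite in_itv /= => /andP[/ltW t0 /ltW t1]; apply: derive_line; apply: dF; rewrite t0.
- apply: derivable_within_continuous => t; rewrite in_itv /= => t01.
  by have := derive_line (dF _ t01) => -[].
rewrite scale1r scale0r add0r subr0 mulr1 => ->; exists t => //.
by move: t01; rewrite in_itv /= => /andP[/ltW -> /ltW ->].
Qed.

Lemma coord_le_norm n (v : 'rV[R]_n) j : `|v 0 j| <= `|v|.
Proof.
by rewrite [leRHS]/Num.Def.normr/= mx_normrE; exact: (le_bigmax _ _ (0, j)).
Qed.

Lemma ball_segment (V : normedModType R) (x y v : V) (r t : R) :
  `|x - y| < r / 2 -> `|v| < r / 2 -> 0 <= t <= 1 -> ball x r (t *: v + y).
Proof.
rewrite -ball_normE /= => xy vr /andP[t0 t1].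
rewrite opprD addrCA addrC (le_lt_trans (ler_normB _ _))//.
rewrite [ltRHS]splitr ltrD// (le_lt_trans _ vr)// normrZ ger0_norm//.
by rewrite ler_piMl.
Qed.

(** The linear approximation of a C^1 function is uniform near a point: by the
    mean value theorem the error is [|v|] times the variation of the partial
    derivatives, which are continuous. The uniformity is used both to
    differentiate under an integral and to bound difference quotients on a
    compact manifold. *)
Lemma strictly_differentiable n (F : 'rV[R]_n -> R) (U : set 'rV[R]_n) x0 (e : R) :
  open U -> U x0 -> Ck 1 U F -> 0 < e ->
  exists2 r, 0 < r & forall x v, `|x0 - x| < r -> `|v| < r ->
    `|F (v + x) - F x - 'D_v F x| <= e * `|v|.
Proof.
move=> oU Ux0 [dF DF] e0; have e1 : 0 < e / (2 * n.+1%:R) by rewrite divr_gt0.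
have : \forall z \near x0, U z /\ forall j : 'I_n,
    `|'D_(delta_mx 0 j) F x0 - 'D_(delta_mx 0 j) F z| < e / (2 * n.+1%:R).
  near=> z; split; near: z; first exact: open_nbhs_nbhs.
  apply: filter_forall => j.
  by have /cvgrPdist_lt := DF (delta_mx 0 j) x0 Ux0; exact.
move=> /nbhs_ballP[r /= r0 rP]; exists (r / 2); first by rewrite divr_gt0.
move=> x v xr vr.
have [|t t01 ->] := @mvt_line _ F x v.
  by move=> t t01; apply: dF; have [] := rP _ (ball_segment xr vr t01).
have [Uz dz] := rP _ (ball_segment xr vr t01).
have xB : ball x0 r x.
  have := @ball_segment _ x0 x v r 0 xr vr; rewrite scale0r add0r lexx ler01.
  exact.
have [Ux dx] := rP _ xB.
rewrite !(derive_row_sum v); [|exact: dF|exact: dF].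
rewrite -sumrB (le_trans (ler_norm_sum _ _ _))//.
(* One summand more than there are coordinates, so that [n = 0] is no exception. *)
have -> : e * `|v| = \sum_(j < n.+1) (e / n.+1%:R * `|v|).
  rewrite sumr_const card_ord -[RHS]mulr_natr mulrAC divfK// pnatr_eq0.
rewrite big_ord_recr /= -[leLHS]addr0 lerD//; last first.
  by rewrite mulr_ge0// divr_ge0// ltW.
apply: ler_sum => j _; rewrite -scalerBr normrZ mulrC ler_pM ?coord_le_norm//.
rewrite -(subrKA ('D_(delta_mx 0 j) F x0)) (le_trans (ler_normD _ _))//.
rewrite distrC (le_trans (ltW (ltrD (dz j) (dx j))))//.
by rewrite invfM mulrA -mulrDl -splitr.
Unshelve. all: by end_near. Qed.

(** The left-hand side is symmetric in [u] and [v], while the right-hand side,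
    obtained from two applications of the mean value theorem, singles out one
    order of differentiation. *)
Lemma second_difference (V : normedModType R) (F : V -> R) (x u v : V) (s r : R) :
  Ck 2 (ball x r) F -> 0 <= s -> s * (`|u| + `|v|) < r ->
  exists2 y, `|x - y| <= s * (`|u| + `|v|) &
   F (s *: u + s *: v + x) - F (s *: u + x) - F (s *: v + x) + F x
   = s ^+ 2 * 'D_v ('D_u F) y.
Proof.
move=> [dF DF] s0 sr.
have inb a b : 0 <= a <= s -> 0 <= b <= s ->
    `|x - (a *: u + b *: v + x)| <= s * (`|u| + `|v|).
  move=> /andP[a0 la] /andP[b0 lb].
  rewrite opprD addrCA subrr addr0 normrN (le_trans (ler_normD _ _))//.
  by rewrite !normrZ !ger0_norm// mulrDr lerD// ler_wpM2r.
have inB a b : 0 <= a <= s -> 0 <= b <= s -> ball x r (a *: u + b *: v + x).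
  by move=> a0 b0; rewrite -ball_normE /=; exact: le_lt_trans (inb _ _ a0 b0) sr.
have ts t : 0 <= t <= 1 -> 0 <= t * s <= s.
  by move=> /andP[t0 t1]; rewrite mulr_ge0// ler_piMl.
have s0s : 0 <= s <= s by apply/andP; split.
have z0s : (0 : R) <= (0 : R) <= s by rewrite lexx s0.
pose H y := F (s *: v + y) - F y.
have shiftd y : ball x r (s *: v + y) -> differentiable (fun z => F (s *: v + z)) y.
  by move=> B; apply: (@differentiable_comp _ _ _ _ (fun z => s *: v + z) F) => //; exact: dF.
have Dshift y w : ball x r (s *: v + y) -> 'D_w (fun z => F (s *: v + z)) y = 'D_w F (s *: v + y).
  move=> B; rewrite (@derive_comp _ _ _ _ (fun z => s *: v + z) F) //; last exact: dF.
  rewrite (_ : (fun z => s *: v + z) = cst (s *: v) + id)//.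
  by rewrite deriveD// derive_cst derive_id add0r.
have dH t : 0 <= t <= 1 -> differentiable H (t *: (s *: u) + x).
  move=> t01; rewrite scalerA; apply: differentiableB.
    by apply: shiftd; rewrite addrA (addrC (s *: v)); apply: inB => //; exact: ts.
  by apply: dF; have := inB (t * s) 0 (ts _ t01) z0s; rewrite scale0r addr0.
have [t t01 Ht] := mvt_line dH.
have B0 : ball x r ((t * s) *: u + x).
  by have := inB (t * s) 0 (ts _ t01) z0s; rewrite scale0r addr0.
have Bs : ball x r (s *: v + ((t * s) *: u + x)).
  by rewrite addrA (addrC (s *: v)); exact: (inB _ _ (ts _ t01)).
have [[dDF _] [dDu DDu]] := (DF u, DF u).
have [|t' t'01 Ht'] := @mvt_line _ ('D_u F) ((t * s) *: u + x) (s *: v).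
  move=> t' t'01; apply: dDF; rewrite scalerA addrA (addrC (_ *: v)).
  by apply: inB; exact: ts.
exists ((t * s) *: u + (t' * s) *: v + x); first by apply: inb; exact: ts.
have -> : F (s *: u + s *: v + x) - F (s *: u + x) - F (s *: v + x) + F x
    = H (s *: u + x) - H x.
  by rewrite /H [s *: v + (_ + _)]addrA (addrC (s *: v) (s *: u)); ring.
rewrite Ht scalerA deriveB; last 2 first.
- by apply: diff_derivable; exact: shiftd.
- by apply: diff_derivable; exact: dF.
rewrite Dshift// [in LHS]deriveE; last exact: dF.
rewrite [in LHS]deriveE; last exact: dF.
rewrite !linearZ /= -!deriveE; [|exact: dF|exact: dF].
rewrite -scalerDr Ht' scalerA deriveE; last first.
  by apply: dDF; rewrite addrA (addrC (_ *: v)); apply: inB; exact: ts.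
rewrite linearZ /= -deriveE; last first.
  by apply: dDF; rewrite addrA (addrC (_ *: v)); apply: inB; exact: ts.
by rewrite -[_ *: _]/(s * _) addrA (addrC (_ *: v)) mulrA -expr2.
Qed.

Lemma dist_half (a b c e : R) :
  `|a - c| < e / 2 -> `|b - c| < e / 2 -> `|a - b| <= e.
Proof.
move=> ac bc; rewrite (le_trans (ler_distD c _ _))// [leRHS]splitr.
by rewrite lerD ?(ltW ac)// distrC ltW.
Qed.

Lemma continuous_pair_ball (V : normedModType R) (g h : V -> R) (U : set V)
    (x : V) (e : R) :
  open U -> U x -> {for x, continuous g} -> {for x, continuous h} -> 0 < e ->
  exists2 r, 0 < r & forall z, ball x r z ->
    [/\ U z, `|g x - g z| < e & `|h x - h z| < e].
Proof.
move=> oU Ux /cvgrPdist_lt gc /cvgrPdist_lt hc e0.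
have : \forall z \near x, [/\ U z, `|g x - g z| < e & `|h x - h z| < e].
  by near=> z; split; near: z; [exact: open_nbhs_nbhs|exact: gc|exact: hc].
by move=> /nbhs_ballP[r /= r0 rP]; exists r.
Unshelve. all: by end_near. Qed.

(** Both second derivatives are limits of the same second difference quotient. *)
Lemma derive_swap (V : normedModType R) (F : V -> R) (U : set V) (x u v : V) :
  open U -> U x -> Ck 2 U F -> 'D_u ('D_v F) x = 'D_v ('D_u F) x.
Proof.
move=> oU Ux CF; apply/eqP; rewrite -subr_eq0 -normr_le0; apply/ler_addgt0Pr => e e0.
rewrite add0r; have e2 : 0 < e / 2 by rewrite divr_gt0.
have [_ DF] := CF; have [[_ DFv] [_ DFu]] := (DF v, DF u).
have [r r0 rP] := continuous_pair_ball oU Ux (DFv u x Ux) (DFu v x Ux) e2.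
have CB : Ck 2 (ball x r) F by apply: Ck_sub CF => z /rP[].
(* Small enough for the parallelogram spanned by [s u] and [s v] to stay in the
   ball; the 1 avoids a division by 0. *)
pose s := r / 2 / (`|u| + `|v| + 1).
have N0 : 0 < `|u| + `|v| + 1 by rewrite ltr_wpDl// addr_ge0.
have s0 : 0 < s by rewrite !divr_gt0.
have sr : s * (`|u| + `|v|) < r.
  rewrite (@lt_le_trans _ _ (s * (`|u| + `|v| + 1)))//.
    by rewrite ltr_pM2l// ltrDl.
  by rewrite divfK ?gt_eqF// ler_pdivrMr// ler_peMr ?ler1n// ltW.
have [y yr Hy] := second_difference CB (ltW s0) sr.
have sr' : s * (`|v| + `|u|) < r by rewrite addrC.
have [z zr Hz] := second_difference CB (ltW s0) sr'.
have E : 'D_v ('D_u F) y = 'D_u ('D_v F) z.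
  have s20 : s ^+ 2 != 0 by rewrite expf_neq0// gt_eqF.
  apply: (mulfI s20).
  apply: etrans (esym Hy) _.
  apply: etrans Hz.
  rewrite (addrC (s *: u)).
  by congr (_ + _); exact: addrAC.
have By : ball x r y by rewrite -ball_normE; exact: le_lt_trans yr sr.
have Bz : ball x r z by rewrite -ball_normE; exact: le_lt_trans zr sr'.
have [_ _ hy] := rP y By; have [_ hz _] := rP z Bz.
by apply: dist_half hz _; rewrite -E.
Qed.

End MeanValue.

(** * Integrals along segments and Hadamard's lemma *)

Section Hadamard.
Variable R : realType.
Notation mu := (@lebesgue_measure R).

Lemma linear_rV_continuous n (L : {linear 'rV[R]_n -> R}) : continuous L.
Proof.
have -> : (L : _ -> _) = (fun v => \sum_j v 0 j * L (delta_mx 0 j)).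
  apply/funext => v; rewrite {1}(row_sum_delta v) linear_sum.
  by apply: eq_bigr => j _; rewrite linearZ.
move=> v; apply: (Ck_sum (k := 0) (index_enum 'I_n) openT) => // j w _.
by apply: (@continuousM R _ (fun v : 'rV[R]_n => v 0 j) (cst _) w); [exact: coord_continuous|exact: cst_continuous].
Qed.

(** A linear approximation in epsilon-delta form determines the differential. *)
Lemma differentiable_approx (V : normedModType R) (h : V -> R) x
    (L : {linear V -> R}) :
  continuous L ->
  (forall e, 0 < e -> exists2 r, 0 < r &
    forall v, `|v| < r -> `|h (v + x) - h x - L v| <= e * `|v|) ->
  differentiable h x /\ 'd h x = L :> (V -> R).
Proof.
move=> cL hL.
have hE : h \o shift x = cst (h x) + L +o_ 0 id.
  apply/eqaddoP => e e0; have [r r0 hr] := hL e e0.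
  apply/nbhs_ballP; exists r => //= v; rewrite -ball_normE /= sub0r normrN => vr.
  rewrite [X in `|X|](_ : _ = h (v + x) - h x - L v); first exact: hr.
  by rewrite !fctE /cst /= opprD addrA.
have dhL := diff_unique cL hE.
by split=> //; apply/diff_locallyP; rewrite dhL.
Qed.

Lemma continuous_normP (V : normedModType R) (f : V -> R) (x : V) :
  {for x, continuous f} <->
  (forall e, 0 < e -> exists2 r, 0 < r &
    forall y, `|x - y| < r -> `|f x - f y| < e).
Proof.
split=> [/cvgrPdist_lt fc e e0|fc].
  have /nbhs_ballP[r /= r0 rP] := fc e e0.
  by exists r => // y xy; apply: rP; rewrite -ball_normE.
apply/cvgrPdist_lt => e e0; have [r r0 rP] := fc e e0.
by apply/nbhs_ballP; exists r => // y; rewrite -ball_normE; exact: rP.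
Qed.

Lemma integrable01 (f : R -> R) :
  (forall t, 0 <= t <= 1 -> {for t, continuous f}) ->
  mu.-integrable `[0, 1] (EFin \o f).
Proof.
move=> fc; apply: continuous_compact_integrable; first exact: segment_compact.
by apply: continuous_in_subspaceT => t; rewrite inE /= in_itv /=; exact: fc.
Qed.

Lemma Rintegral01_le (f : R -> R) (c : R) :
  mu.-integrable `[0, 1] (EFin \o f) ->
  (forall t, 0 <= t <= 1 -> `|f t| <= c) ->
  `|\int[mu]_(t in `[0, 1]) f t| <= c.
Proof.
move=> fi fc; apply: le_trans (le_normr_Rintegral _ fi) _ => //.
have -> : c = \int[mu]_(t in `[0, 1]) c.
  by rewrite Rintegral_cst//= lebesgue_measure_itv /= lte_fin ltr01 sube0 mulr1.
apply: le_Rintegral => //.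
- exact: (integrable_norm fi).
- by apply: (@integrable01 (cst c)) => t _; exact: cvg_cst.
Qed.

Lemma seg_sub (V : lmodType R) (t s : R) (x p v : V) :
  t *: (x - p) + p - (s *: (v + x - p) + p) = (t - s) *: (x - p) - s *: v.
Proof.
rewrite opprD addrACA subrr addr0 -addrA (scalerDr s) opprD addrCA.
by rewrite -scalerBl addrC.
Qed.

Section ParamIntegral.
Variables (n : nat) (p : 'rV[R]_n) (r : R).
Notation U := (ball p r).

Let seg (t : R) (x : 'rV[R]_n) := t *: (x - p) + p.

(** The integral of [G] over the segment from [p] to [x]. The weight [t ^+ m] is
    there because differentiating in [x] produces one more factor [t]. *)
Definition segment_integral m (G : 'rV[R]_n -> R) x :=
  \int[mu]_(t in `[0, 1]) (t ^+ m * G (seg t x)).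

Lemma seg_ball t x : U x -> 0 <= t <= 1 -> U (seg t x).
Proof.
rewrite -!ball_normE /= => xr /andP[t0 t1].
rewrite /seg opprD addrCA subrr addr0 normrN normrZ ger0_norm// distrC.
by apply: le_lt_trans xr; rewrite ler_piMl.
Qed.

Lemma seg_continuous x t : {for t, continuous (seg^~ x)}.
Proof.
rewrite /seg; apply: cvgD; last exact: cvg_cst.
by apply: cvgZr_tmp; exact: cvg_id.
Qed.

Lemma seg_integrable m G x : U x -> (forall y, U y -> {for y, continuous G}) ->
  mu.-integrable `[0, 1] (EFin \o (fun t => t ^+ m * G (seg t x))).
Proof.
move=> Ux Gc; apply: integrable01 => t t01; apply: cvgM.
  exact: exprn_continuous.
apply: (@continuous_comp _ _ _ (seg^~ x) G); first exact: seg_continuous.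
exact/Gc/seg_ball.
Qed.

(** Compactness of [[0, 1]], in the form used to make estimates uniform along a
    segment. *)
Lemma near_uniform_itv01 (P : R -> 'rV[R]_n -> Prop) :
  (forall t, 0 <= t <= 1 -> exists2 d, 0 < d &
     forall s v, 0 <= s <= 1 -> `|t - s| < d -> `|v| < d -> P s v) ->
  exists2 d, 0 < d & forall s v, 0 <= s <= 1 -> `|v| < d -> P s v.
Proof.
move=> locP; have cI := @segment_compact R 0 1.
have /near_covering_withinP cov := (compact_near_coveringP _).1 cI.
have [|d /= d0 dP] := (nbhs_ballP _ _).1 (cov _ (nbhs (0 : 'rV[R]_n)) (fun v t => P t v) _ _).
  move=> t; rewrite /= in_itv /= => t01; have [d d0 dP] := locP t t01.
  exists (ball t d, ball 0 d); first by split; exact: nbhsx_ballx.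
  move=> [s v] /= [ts v0]; rewrite in_itv /= => s01; apply: dP => //.
  by move: v0; rewrite -ball_normE /= sub0r normrN.
exists d => // s v s01 vd; apply: (dP v); last by rewrite /= in_itv.
by rewrite -ball_normE /= sub0r normrN.
Qed.

Lemma seg_dist x (d : R) : 0 < d -> exists2 d1, 0 < d1 &
  forall t s v, 0 <= s <= 1 -> `|t - s| < d1 -> `|v| < d1 ->
    `|seg t x - seg s (v + x)| < d.
Proof.
move=> d0; have N0 : 0 < 1 + `|x - p| by rewrite ltr_pwDl.
exists (d / (1 + `|x - p|)); first by rewrite divr_gt0.
move=> t s v /andP[s0 s1] ts vd.
rewrite [X in `|X|](seg_sub t s x p v).
apply: le_lt_trans (ler_normB _ _) _.
rewrite !normrZ (ger0_norm s0) -[ltRHS](divfK (lt0r_neq0 N0)).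
rewrite mulrDr mulr1 addrC ltr_leD//.
  by apply: le_lt_trans vd; rewrite ler_piMl.
by rewrite ler_wpM2r// ltW.
Qed.

Lemma segment_integral_continuous m G : (forall y, U y -> {for y, continuous G}) ->
  forall x, U x -> {for x, continuous (segment_integral m G)}.
Proof.
move=> Gc x Ux; apply/continuous_normP => e e0.
have e2 : 0 < e / 2 by rewrite divr_gt0.
have e4 : 0 < e / 2 / 2 by rewrite divr_gt0.
have [t t01|d d0 dP] := near_uniform_itv01 (P := fun t v => U (v + x) ->
    `|G (seg t x) - G (seg t (v + x))| <= e / 2).
  have /continuous_normP/(_ _ e4)[d d0 dG] := Gc _ (seg_ball Ux t01).
  have [d1 d10 d1P] := seg_dist x d0; exists d1 => // s v s01 ts vd _.
  apply: (@dist_half _ _ _ (G (seg t x))); rewrite distrC; apply: dG; last exact: d1P.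
  by rewrite -[X in seg s X]add0r; apply: d1P => //; rewrite normr0.
have /nbhs_ballP[d' /= d'0 d'U] : nbhs x U.
  by apply: open_nbhs_nbhs; split=> //; exact: ball_open.
exists (Num.min d d'); first by rewrite lt_min d0 d'0.
move=> y; rewrite lt_min => /andP[yd yd'].
have Uy : U y by apply: d'U; rewrite -ball_normE.
apply: (@le_lt_trans _ _ (e / 2)); last by rewrite ltr_pdivrMr// ltr_pMr// ltr1n.
rewrite /segment_integral -RintegralB//; [|exact: seg_integrable..].
apply: Rintegral01_le.
  apply: integrable01 => t t01; apply: cvgB; apply: cvgM;
    [exact: exprn_continuous| |exact: exprn_continuous|].
    apply: (@continuous_comp _ _ _ (seg^~ x) G); first exact: seg_continuous.
    exact/Gc/seg_ball.
  apply: (@continuous_comp _ _ _ (seg^~ y) G); first exact: seg_continuous.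
  exact/Gc/seg_ball.
move=> t t01; rewrite -mulrBr normrM -[leRHS]mul1r ler_pM//.
  by have /andP[t0 t1] := t01; rewrite normrX ger0_norm// exprn_ile1.
have := dP t (y - x) t01; rewrite distrC subrK; exact.
Qed.

Lemma segment_integral_linear m G x : (forall y, U y -> differentiable G y) ->
  (forall v y, U y -> {for y, continuous ('D_v G)}) -> U x ->
  linear (fun v => segment_integral m ('D_v G) x : R).
Proof.
move=> dG cDG Ux a v w; rewrite /segment_integral.
have [iv iw] := (seg_integrable m Ux (cDG v), seg_integrable m Ux (cDG w)).
rewrite -[RHS]/(a * _ + _) -(RintegralZl a _ iv)//.
have ia := @integrableZl _ _ _ mu `[0, 1] (measurable_itv _) a _ iv.
rewrite -(RintegralD _ ia iw)//.
apply: eq_Rintegral => t; rewrite inE /= in_itv /= => t01.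
rewrite deriveE; last exact/dG/seg_ball.
rewrite linearP /= -!deriveE; [|exact/dG/seg_ball..].
by rewrite -[_ *: 'D_v _ _]/(_ * _); ring.
Qed.

(** Differentiation under the integral sign: the first-order error is uniform
    along the segment, by [strictly_differentiable] and compactness. *)
Lemma segment_integral_derive m G : Ck 1 U G -> forall x, U x ->
  differentiable (segment_integral m G) x /\
  forall v, 'D_v (segment_integral m G) x = segment_integral m.+1 ('D_v G) x.
Proof.
move=> CG x Ux; have [dG cDG] := CG.
have cG y : U y -> {for y, continuous G} by move=> /dG; exact: differentiable_continuous.
pose L : {linear 'rV[R]_n -> R} := HB.pack (fun v => segment_integral m.+1 ('D_v G) x : R)
  (GRing.isLinear.Build _ _ _ _ _ (segment_integral_linear m.+1 dG cDG Ux)).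
have oU : open U by exact: ball_open.
have [|dh dhE] := @differentiable_approx _ (segment_integral m G) x L (@linear_rV_continuous _ L); last first.
  by split=> // v; rewrite deriveE// dhE.
move=> e e0.
have [t t01|d d0 dP] := near_uniform_itv01 (P := fun t v => U (v + x) ->
    `|G (t *: v + seg t x) - G (seg t x) - t * 'D_v G (seg t x)| <= e * `|v|).
  have [d d0 dG'] := strictly_differentiable oU (seg_ball Ux t01) CG e0.
  have [d1 d10 d1P] := seg_dist x d0; exists (Num.min d d1); first by rewrite lt_min d0.
  move=> s v s01 tsd vd _.
  have [s0 s1] := andP s01.
  have sv : `|s *: v| <= `|v| by rewrite normrZ ger0_norm// ler_piMl.
  move: tsd vd; rewrite !lt_min => /andP[tsd tsd1] /andP[vd vd1].
  have E : 'D_(s *: v) G (seg s x) = s * 'D_v G (seg s x).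
    by rewrite deriveE ?linearZ /= -?deriveE//; exact/dG/seg_ball.
  rewrite -E; apply: le_trans (dG' _ _ _ _) _.
  - by rewrite -[X in seg s X]add0r; apply: d1P => //; rewrite normr0.
  - exact: le_lt_trans sv vd.
  - by rewrite ler_wpM2l// ltW.
have /nbhs_ballP[d' /= d'0 d'U] : nbhs x U.
  by apply: open_nbhs_nbhs; split=> //.
exists (Num.min d d'); first by rewrite lt_min d0 d'0.
move=> v; rewrite lt_min => /andP[vd vd'].
have Uy : U (v + x).
  by apply: d'U; rewrite -ball_normE /= opprD addrCA subrr addr0 normrN.
have [ia ib] := (seg_integrable m Uy cG, seg_integrable m Ux cG).
have ic := seg_integrable m.+1 Ux (cDG v).
have iab := @integrableB _ _ _ mu `[0, 1] (measurable_itv _) _ _ ia ib.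
have iabc := @integrableB _ _ _ mu `[0, 1] (measurable_itv _) _ _ iab ic.
rewrite /L /= /segment_integral -(RintegralB _ ia ib)// -(RintegralB _ iab ic)//.
apply: (Rintegral01_le iabc).
move=> t t01; have [t0 t1] := andP t01.
rewrite exprSr -!mulrA -!mulrBr normrM -[leRHS]mul1r ler_pM//.
  by rewrite normrX ger0_norm// exprn_ile1.
have := dP t v t01 vd Uy.
by rewrite (_ : seg t (v + x) = t *: v + seg t x)// /seg -[v + x - p]addrA scalerDr addrA.
Qed.

Lemma Ck_segment_integral k m G : Ck k U G -> Ck k U (segment_integral m G).
Proof.
have oU : open U by exact: ball_open.
elim: k m G => [|k IHk] m G CG; first exact: segment_integral_continuous.
have C1 : Ck 1 U G by apply: Ck_le CG.
split=> [x Ux|v]; first by have [] := segment_integral_derive m C1 Ux.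
have [_ DG] := CG; apply: Ck_ext (IHk m.+1 _ (DG v)) => // x Ux.
by have [_ ->] := segment_integral_derive m C1 Ux.
Qed.

(** The fundamental theorem of calculus for [G] on the segment from [p] to [x].
    By [Ck_segment_integral] the coefficients on the right are as smooth as the
    derivatives of [G], so that [G - G p] lies in the ideal generated by the
    coordinates. *)
Lemma Hadamard G : Ck 1 U G -> forall x, U x ->
  G x - G p = \sum_j (x - p) 0 j * segment_integral 0 ('D_(delta_mx 0 j) G) x.
Proof.
move=> CG x Ux; have [dG cDG] := CG.
have lp := segment_integral_linear 0 dG cDG Ux.
pose L : {linear 'rV[R]_n -> R} := HB.pack (fun v => segment_integral 0 ('D_v G) x : R)
  (GRing.isLinear.Build _ _ _ _ _ lp).
transitivity (L (x - p)); last first.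
  rewrite {1}(row_sum_delta (x - p)) linear_sum.
  by apply: eq_bigr => j _; rewrite linearZ.
have dl (t : R) : 0 <= t <= 1 -> is_derive t (1:R) (fun s => G (seg s x)) ('D_(x - p) G (seg t x)).
  by move=> t01; apply: derive_line; apply: dG; exact: (seg_ball Ux).
have := @continuous_FTC2 R (fun t => 'D_(x - p) G (seg t x)) (fun t => G (seg t x)) 0 1 ltr01.
have seg1 : seg 1 x = x by rewrite /seg scale1r subrK.
have seg0 : seg 0 x = p by rewrite /seg scale0r add0r.
have cG (t : R) : 0 <= t <= 1 -> G (seg s x) @[s --> t] --> G (seg t x).
  move=> /dl[/derivable1_diffP/differentiable_continuous + _]; exact.
rewrite seg1 seg0 /L /= /segment_integral /Rintegral => FTC.
under eq_integral do rewrite expr0 mul1r.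
rewrite FTC//.
- apply: continuous_in_subspaceT => t; rewrite inE /= in_itv /= => t01.
  apply: (@continuous_comp _ _ _ (seg^~ x) ('D_(x - p) G)); first exact: seg_continuous.
  exact/cDG/seg_ball.
- split.
  + by move=> t; rewrite in_itv /= => /andP[/ltW t0 /ltW t1]; have [] := dl t; rewrite ?t0.
  + by apply: cvg_at_right_filter; apply: cG; rewrite lexx ler01.
  + by apply: cvg_at_left_filter; apply: cG; rewrite lexx ler01.
- move=> t; rewrite in_itv /= => /andP[/ltW t0 /ltW t1].
  by rewrite derive1E; apply: derive_val; apply: dl; rewrite t0.
Qed.

End ParamIntegral.
End Hadamard.

(** * A smooth function that is flat at the origin *)

Section FlatFunction.
Variable R : realType.

(** For [P = 1] this is the classical function exp(-1/x). The polynomial factor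
    makes the family stable under differentiation. *)
Definition flat (P : {poly R}) (x : R) : R :=
  if 0 < x then P.[x^-1] * expR (- x^-1) else 0.

Lemma horner_expR_bound (P : {poly R}) : exists C : R,
  forall u, 0 <= u -> `|P.[u]| * expR (- u) * u ^+ 2 <= C.
Proof.
(* From [u ^+ (i + 2) / (i + 2)! <= exp u]. *)
exists (\sum_(i < size P) `|P`_i| * (i.+2)`!%:R) => u u0.
rewrite horner_coef -mulrA.
apply: le_trans (ler_wpM2r _ (ler_norm_sum _ _ _)) _.
  by rewrite mulr_ge0 ?expR_ge0// exprn_ge0.
rewrite mulr_suml; apply: ler_sum => i _.
rewrite normrM (ger0_norm (exprn_ge0 _ u0)) -mulrA ler_wpM2l//.
rewrite mulrCA -exprD addn2 expRN ler_pdivrMl ?expR_gt0//.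
rewrite -ler_pdivrMr ?ltr0n ?fact_gt0//.
by apply: le_trans (expR_ge1Dxn i.+1 u0); rewrite lerDr.
Qed.

Lemma flat_le0 P x : x <= 0 -> flat P x = 0.
Proof. by rewrite /flat leNgt; case: ifP. Qed.

(** At 0 the difference quotient tends to 0, because exp(-1/x) is smaller than
    every power of x. Elsewhere this is the usual computation. *)
Lemma differentiable_flat P x : differentiable (flat P) x /\
  forall v, 'D_v (flat P) x = v * flat ('X^2 * (P - P^`())) x.
Proof.
pose Q := 'X^2 * (P - P^`()).
suff H : is_derive x (1 : R) (flat P) (flat Q x).
  have [/derivable1_diffP dP DP] := H; split=> // v.
  have vE : v = v *: (1 : R) by rewrite -[_ *: _]/(_ * _) mulr1.
  by rewrite deriveE// {1}vE linearZ /= -deriveE// DP.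
have [x0|x0|x0] := ltgtP x 0.
- have -> : flat Q x = 0 by rewrite flat_le0 ?ltW.
  apply: (@near_eq_is_derive R R R (cst 0)).
  by near=> y; rewrite flat_le0// ltW//; near: y; exact: lt_nbhsl.
- apply: (@near_eq_is_derive R R R (fun y : R => P.[y^-1] * expR (- y^-1))).
  + near=> y; rewrite /flat ifT//; near: y; exact: lt_nbhsr.
  + have xn0 : x != 0 by rewrite gt_eqF.
    have di : is_derive x (1:R) (fun y : R => y^-1) (- x ^- 2).
      apply: is_derive_eq; first exact: is_deriveV.
      by rewrite -[_ *: _]/(_ * _) mulr1.
    have dp : is_derive x (1:R) (fun y : R => P.[y^-1]) ((- x ^- 2) * P^`().[x^-1]).
      by rewrite mulrC; apply: (@is_derive1_comp _ (horner P) (fun y : R => y^-1)).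
    have de : is_derive x (1:R) (fun y : R => expR (- y^-1)) ((x ^- 2) * expR (- x^-1)).
      have dN : is_derive x (1:R) (fun y : R => - y^-1) (x ^- 2).
        by apply: is_derive_eq; rewrite opprK.
      by rewrite mulrC; apply: (@is_derive1_comp _ expR (fun y : R => - y^-1)).
    apply: is_derive_eq.
    rewrite /flat x0 /Q hornerM hornerXn hornerD hornerN exprVn.
    by rewrite -[_ *: _]/(_ * _) -[X in _ + X]/(_ * _); ring.
- rewrite x0 (_ : flat Q 0 = 0); last by rewrite flat_le0.
  have [C CP] := horner_expR_bound P.
  have [|e e0|d0 dE] := @differentiable_approx R R (flat P) 0 [the {linear R -> R} of \0].
  + by move=> y; exact: cst_continuous.
  + exists (e / (`|C| + 1)); first by rewrite divr_gt0// ltr_wpDl.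
    move=> v vr; rewrite (_ : _ - _ - _ = flat P v); last first.
      by rewrite addr0 (flat_le0 P (lexx 0)) /= !subr0.
    rewrite /flat; case: ifPn => v0; last by rewrite normr0 mulr_ge0// ltW.
    have := CP v^-1; rewrite invr_ge0 (ltW v0) => /(_ isT).
    rewrite exprVn ler_pdivrMr ?exprn_gt0// => H.
    rewrite normrM (ger0_norm (expR_ge0 _)) (le_trans H)//.
    rewrite expr2 mulrA (gtr0_norm v0) ler_pM2r//.
    move: vr; rewrite (gtr0_norm v0) ltr_pdivlMr ?ltr_wpDl// => /ltW.
    apply: le_trans; rewrite mulrC ler_pM2l//.
    by rewrite (le_trans (ler_norm C))// lerDl.
  apply: DeriveDef; first exact/derivable1_diffP.
  by rewrite deriveE// dE.
Unshelve. all: by end_near. Qed.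

Lemma flat_gt0 x : 0 < x -> 0 < flat 1 x.
Proof. by move=> x0; rewrite /flat x0 hornerC mul1r expR_gt0. Qed.

End FlatFunction.

(** * Smoothness near a point of a manifold *)

Section LocalSmoothness.
Variable R : realType.

Lemma open_preimage_on (T T' : topologicalType) (f : T -> T') (A : set T) (B : set T') :
  open A -> open B -> (forall x, A x -> {for x, continuous f}) ->
  open (A `&` f @^-1` B).
Proof.
move=> oA oB fc; rewrite openE => x [Ax Bfx].
apply: filterI; first exact: open_nbhs_nbhs.
by apply: fc => //; exact: open_nbhs_nbhs.
Qed.

Section Charts.
Variables (n : nat) (M : topologicalType) (c : chart R n M).
Hypothesis cc : is_chart c.

Lemma chart_cancel p : chart_dom c p -> chart_inv c (c p) = p.
Proof. by have [_ _ + _ _] := cc; apply. Qed.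

Lemma chart_open_img : open (chart_img c).
Proof. by have [_ + _ _ _] := cc. Qed.

Lemma chart_invP x : chart_img c x ->
  chart_dom c (chart_inv c x) /\ c (chart_inv c x) = x.
Proof. by case=> p dp <-; rewrite chart_cancel. Qed.

Lemma chart_image_subset (O : set M) :
  c @` (chart_dom c `&` O) = chart_img c `&` chart_inv c @^-1` O.
Proof.
apply/seteqP; split=> [_ [p [dp Op] <-]|x [/chart_invP[dx cx] Ox]].
  by split; [exists p|rewrite /= chart_cancel].
by exists (chart_inv c x).
Qed.

Lemma chart_open_image (O : set M) : open O -> open (c @` (chart_dom c `&` O)).
Proof.
move=> oO; rewrite chart_image_subset; apply: open_preimage_on => //.
  exact: chart_open_img.
by have [_ _ _ _] := cc.
Qed.

Lemma chart_open_preimage (W : set 'rV[R]_n) : open W ->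
  open (chart_dom c `&` c @^-1` W).
Proof. by have [oD _ _ cD _] := cc => oW; exact: open_preimage_on. Qed.

End Charts.

(** Smoothness in one chart around [p]; by [smooth_at_chart] any chart would do.
    The neighbourhood may depend on the order [k] of differentiation. *)
Definition smooth_at (n : nat) (M : manifoldType R n) (f : M -> R) (p : M) :=
  exists2 c : chart R n M, atlas c /\ chart_dom c p &
    forall k, exists W, [/\ open W, W (c p) & Ck k W (f \o chart_inv c)].

Lemma Ck_local (V W : normedModType R) k (U : set V) (f : V -> W) :
  (forall x, U x -> exists U', [/\ open U', U' x & Ck k U' f]) -> Ck k U f.
Proof.
move=> fl; apply/Ck_at => x Ux; have [U' [_ U'x fU']] := fl x Ux.
by apply: Ck_sub fU' => _ ->.
Qed.

Section OneManifold.
Variables (n : nat) (M : manifoldType R n).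
Implicit Types (f g : M -> R) (p : M).

(** Transition maps are smooth, so smoothness at a point can be read in any
    chart. *)
Lemma smooth_at_chart f p (d : chart R n M) : smooth_at f p -> atlas d ->
  chart_dom d p -> forall k, exists W,
  [/\ open W, W (d p), W `<=` chart_img d & Ck k W (f \o chart_inv d)].
Proof.
move=> [c [ac cp] fc] ad dp k; have [W [oW Wp fW]] := fc k.
have [hc hd] := (atlas_chart _ ac, atlas_chart _ ad).
pose O := chart_dom c `&` c @^-1` W.
have oO : open O by exact: chart_open_preimage.
exists (d @` (chart_dom d `&` O)); split.
- exact: chart_open_image.
- by exists p.
- by move=> _ [q [dq _] <-]; exists q.
have Ct : Ck k (d @` (chart_dom d `&` O)) (c \o chart_inv d).
  by apply: Ck_sub (atlas_compat _ _ ad ac k) => _ [q [dq [cq _]] <-]; exists q.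
have sub x : (d @` (chart_dom d `&` O)) x -> W ((c \o chart_inv d) x).
  by move=> [q [dq [cq Wq]] <-] /=; rewrite chart_cancel.
have H := Ck_comp_real (chart_open_image hd oO) oW sub Ct fW.
apply: Ck_ext H; first exact: chart_open_image.
by move=> _ [q [dq [cq Wq]] <-] /=; rewrite (chart_cancel hd)// chart_cancel.
Qed.

Lemma smooth_funP f : f \in smooth_fun M <-> forall p, smooth_at f p.
Proof.
rewrite inE; split=> [sf p|sf c ac k].
  have [c ac cp] := atlas_cover p; exists c => // k.
  exists (chart_img c); split; [exact/chart_open_img/atlas_chart| |exact: sf].
  by exists p.
apply: Ck_local => _ [p cp <-]; have [W [oW Wp _ CW]] := smooth_at_chart (sf p) ac cp k.
by exists W.
Qed.

Lemma smooth_at_ext f g p : (\forall x \near p, f x = g x) ->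
  smooth_at f p -> smooth_at g p.
Proof.
move=> fg0; have := (fg0 : nbhs p [set x | f x = g x]); rewrite nbhsE => -[N [oO Op] fg] [c [ac cp] fc]; exists c => // k.
have hc := atlas_chart _ ac; have [W [oW Wp fW]] := fc k.
have oS := openI oW (chart_open_image hc oO).
exists (W `&` c @` (chart_dom c `&` N)); split=> //; first by split=> //; exists p.
apply: (Ck_ext oS _ (Ck_sub _ fW)); last by move=> ? [].
by move=> _ [_ [q [cq Oq] <-]] /=; rewrite chart_cancel//; exact: fg.
Qed.

Lemma smooth_at_pair f g p : smooth_at f p -> smooth_at g p ->
  exists2 c : chart R n M, atlas c /\ chart_dom c p & forall k, exists W,
  [/\ open W, W (c p), Ck k W (f \o chart_inv c) & Ck k W (g \o chart_inv c)].
Proof.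
move=> [c [ac cp] fc] sg; exists c => // k.
have [W [oW Wp fW]] := fc k; have [W' [oW' W'p _ gW]] := smooth_at_chart sg ac cp k.
exists (W `&` W'); split=> //; first exact: openI.
  by apply: Ck_sub fW => ? [].
by apply: Ck_sub gW => ? [].
Qed.

Lemma smooth_at_cst (a : R) p : smooth_at (cst a) p.
Proof. exact: (smooth_funP _).1 (smooth_fun_cst M a) p. Qed.

Lemma smooth_atD f g p : smooth_at f p -> smooth_at g p -> smooth_at (f + g) p.
Proof.
move=> sf sg; have [c ac H] := smooth_at_pair sf sg; exists c => // k.
by have [W [oW Wp fW gW]] := H k; exists W; split=> //; exact: CkD.
Qed.

Lemma smooth_atM f g p : smooth_at f p -> smooth_at g p -> smooth_at (f * g) p.
Proof.
move=> sf sg; have [c ac H] := smooth_at_pair sf sg; exists c => // k.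
by have [W [oW Wp fW gW]] := H k; exists W; split=> //; exact: CkM.
Qed.

Lemma Cinfty_smooth_at (f : Cinfty M) p : smooth_at f p.
Proof. exact: (smooth_funP _).1 (CinftyP f) p. Qed.

Lemma smooth_at_continuous f p : smooth_at f p -> {for p, continuous f}.
Proof.
move=> [c [ac cp] /(_ 0)[W [oW Wp fW]]]; have [oD _ _ cD _] := atlas_chart _ ac.
have : {for p, continuous ((f \o chart_inv c) \o c)}.
  by apply: continuous_comp; [exact: cD|exact: fW].
have E : {near p, (f \o chart_inv c) \o c =1 f}.
  have : nbhs p (chart_dom c) by exact: open_nbhs_nbhs.
  by apply: filterS => x cx /=; rewrite chart_cancel//; exact: atlas_chart.
rewrite /prop_for /continuous_at /= (chart_cancel (atlas_chart _ ac) cp).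
by apply: cvg_trans; exact: near_eq_cvg.
Qed.

Lemma smooth_at_chart_comp (c : chart R n M) p (G : 'rV[R]_n -> R) :
  atlas c -> chart_dom c p ->
  (forall k, exists W, [/\ open W, W (c p) & Ck k W G]) ->
  smooth_at (G \o c) p.
Proof.
move=> ac cp GC; exists c => // k; have [W [oW Wp CW]] := GC k.
have hc := atlas_chart _ ac; have oS := openI oW (chart_open_img hc).
exists (W `&` chart_img c); split=> //; first by split=> //; exists p.
apply: (Ck_ext oS _ (Ck_sub _ CW)); last by move=> ? [].
by move=> x [_ /(chart_invP hc)[_ cx]] /=; rewrite cx.
Qed.

Lemma smooth_at_coord (c : chart R n M) p j : atlas c -> chart_dom c p ->
  smooth_at (fun x => c x 0 j) p.
Proof.
move=> ac cp; apply: (smooth_at_chart_comp (G := coord_lin 0 j)) => // k.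
exists setT; split=> //; first exact: openT.
by apply: Ck_linear; [exact: openT|exact: coord_continuous].
Qed.

(** A function that is smooth only on an open set becomes globally smooth once it
    is multiplied by a cut-off supported in this set; its values elsewhere do
    not matter since [b] vanishes there. *)
Lemma cutoff_smooth (b : Cinfty M) (K O : set M) (u : M -> R) :
  closed K -> K `<=` O -> (forall x, ~ K x -> b x = 0) ->
  (forall x, O x -> smooth_at u x) -> (b : M -> R) * u \in smooth_fun M.
Proof.
move=> cK KO b0 su; apply/smooth_funP => x; have [Kx|nKx] := pselect (K x).
  by apply: smooth_atM; [exact: Cinfty_smooth_at|exact/su/KO].
apply: smooth_at_ext (smooth_at_cst 0 x).
have : nbhs x (~` K) by apply: open_nbhs_nbhs; split=> //; exact: closed_openC.
by apply: filterS => y nKy; rewrite !fctE /= b0// mul0r.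
Qed.

End OneManifold.
End LocalSmoothness.

(** * Cut-off functions *)

Section BumpFunctions.
Variable R : realType.

Lemma Ck_flat_comp (V : normedModType R) (U : set V) k P (f : V -> R) :
  open U -> Ck k U f -> Ck k U (flat P \o f).
Proof.
move=> oU; have dflat y : differentiable (flat P) y by have [] := differentiable_flat P y.
elim: k P dflat => [|k IHk] P dflat Cf.
  move=> x Ux; apply: continuous_comp; first exact: Cf.
  by apply: differentiable_continuous; exact: dflat.
have [df Df] := Cf; split=> [x Ux|v].
  by apply: differentiable_comp; [exact: df|exact: dflat].
have dQ y : differentiable (flat ('X^2 * (P - P^`()))) y.
  by have [] := differentiable_flat ('X^2 * (P - P^`())) y.
apply: (Ck_ext oU _ (CkM oU (Df v) (IHk _ dQ (CkS Cf)))) => x Ux.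
rewrite [RHS](derive_comp _ (df x Ux) (dflat _)).
by have [_ ->] := differentiable_flat P (f x).
Qed.

(** The cut-off is exp(-1/y) with y = rho^2 - |c x - c p|^2 (Euclidean norm) in
    a chart [c]. Its support [K] is the image of a compact ball, and it is
    closed because the manifold is Hausdorff. *)
Lemma smooth_bump n (M : manifoldType R n) (O : set M) (p : M) : open O -> O p ->
  exists (b : Cinfty M) (K : set M),
    [/\ closed K, K `<=` O, forall x, ~ K x -> b x = 0 & b p != 0].
Proof.
move=> oO Op; have [c ac cp] := atlas_cover p; have hc := atlas_chart _ ac.
have oO' := chart_open_image hc oO.
have /nbhs_ballP[r /= r0 rO] : nbhs (c p) (c @` (chart_dom c `&` O)).
  by apply: open_nbhs_nbhs; split=> //; exists p.
pose rho := r / 2; have rho0 : 0 < rho by rewrite divr_gt0.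
pose Kr := [set w : 'rV[R]_n | `|c p - w| <= rho].
have KrB w : Kr w -> (c @` (chart_dom c `&` O)) w.
  move=> Kw; apply: rO; rewrite -ball_normE /=; apply: le_lt_trans Kw _.
  by rewrite /rho ltr_pdivrMr// ltr_pMr// ltr1n.
have cKr : compact Kr.
  apply: bounded_closed_compact.
    exists (`|c p| + rho); split; first by rewrite num_real.
    move=> m mlt w Kw; apply: le_trans (ltW mlt).
    rewrite -(subKr (c p) w) (le_trans (ler_normB _ _))// lerD2l.
    exact: Kw.
  have -> : Kr = closed_ball_ Num.norm (c p) rho by [].
  exact: closed_closed_ball_.
pose K := chart_inv c @` Kr.
have clK : closed K.
  apply: compact_closed; first exact: manifold_hausdorff.
  apply: continuous_compact cKr; apply: continuous_in_subspaceT => w.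
  rewrite inE => /KrB[q [cq _] <-]; have [_ _ _ _] := hc; apply.
  by exists q.
have KO : K `<=` O.
  by move=> _ [w /KrB[q [cq Oq] <-] <-]; rewrite chart_cancel.
pose G (w : 'rV[R]_n) : R := rho ^+ 2 - \sum_j (w 0 j - c p 0 j) ^+ 2.
pose b x := if asbool (chart_dom c x) then flat 1 (G (c x)) else 0.
have bK x : ~ K x -> b x = 0.
  move=> nKx; rewrite /b; case: asboolP => // cx; apply: flat_le0.
  have : ~ Kr (c x) by move=> Kc; apply: nKx; exists (c x) => //; rewrite chart_cancel.
  move=> /negP; rewrite -ltNge => lt; rewrite /G subr_le0.
  have cpx0 : `|c p - c x| != 0 by rewrite gt_eqF// (lt_trans rho0).
  have [[i j] /=] := mx_norm_neq0 cpx0.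
  rewrite [LHS](_ : _ = `|c p - c x|) // => nE.
  rewrite (bigD1 j)//= (le_trans (y := (c x 0 j - c p 0 j) ^+ 2))//.
    rewrite -[leRHS]real_normK ?num_real// distrC.
    move: nE; rewrite (ord1 i) !mxE => nE.
    by rewrite ler_sqr ?nnegrE ?(ltW rho0)// -nE ltW.
  by rewrite lerDl sumr_ge0// => k _; rewrite sqr_ge0.
have CG k : Ck k setT G.
  have oT := @openT 'rV[R]_n.
  have Cc j : Ck k setT (fun w : 'rV[R]_n => w 0 j - c p 0 j).
    apply: (CkD oT (f := coord_lin 0 j) (g := cst (- c p 0 j))).
      by apply: Ck_linear; [exact: openT|exact: coord_continuous].
    exact: Ck_cst.
  have Cs := Ck_sum (index_enum 'I_n) oT (fun j => CkM oT (Cc j) (Cc j)).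
  have Cr := CkD oT (Ck_cst oT k (rho ^+ 2)) (CkM oT (Ck_cst oT k (-1 : R)) Cs).
  apply: (Ck_ext oT _ Cr) => w _.
  by rewrite /G !fctE mulN1r.
have sb : b \in smooth_fun M.
  apply/smooth_funP => x; have [Kx|nKx] := pselect (K x); last first.
    apply: smooth_at_ext (smooth_at_cst 0 x).
    have : nbhs x (~` K) by apply: open_nbhs_nbhs; split=> //; exact: closed_openC.
    by apply: filterS => y nKy; rewrite bK.
  have cx : chart_dom c x.
    by move: Kx => -[w /KrB[q [cq _] <-] <-]; rewrite chart_cancel.
  apply: (@smooth_at_ext _ _ _ ((flat 1 \o G) \o c)).
    have [oD _ _ _ _] := hc; have : nbhs x (chart_dom c) by exact: open_nbhs_nbhs.
    by apply: filterS => y cy; rewrite /b; case: asboolP.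
  apply: smooth_at_chart_comp => // k; exists setT; split=> //; first exact: openT.
  by apply: Ck_flat_comp; [exact: openT|exact: CG].
exists (SmoothFun sb), K; split=> //.
rewrite /= /b; case: asboolP => // _; rewrite gt_eqF// flat_gt0// /G.
rewrite big1 ?subr0 ?exprn_gt0// => j _.
by rewrite subrr expr0n.
Qed.

End BumpFunctions.

(** * Derivations are directional derivatives *)

Section VectorFields.
Variables (R : realType) (n : nat) (M : manifoldType R n).
Implicit Types (X : vfield M) (f h : Cinfty M) (p : M).

Lemma CinftyDE f h p : (f + h) p = f p + h p. Proof. by []. Qed.
Lemma CinftyME f h p : (f * h) p = f p * h p. Proof. by []. Qed.
Lemma CinftyZE (a : R) f p : (a *: f) p = a * f p. Proof. by []. Qed.
Lemma CinftyNE f p : (- f) p = - f p. Proof. by []. Qed.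
Lemma Cinfty1E p : (1 : Cinfty M) p = 1. Proof. by []. Qed.
Lemma Cinfty0E p : (0 : Cinfty M) p = 0. Proof. by []. Qed.

Definition CinftyE :=
  (CinftyDE, CinftyME, CinftyZE, CinftyNE, Cinfty1E, Cinfty0E).

Lemma Cinfty_eq f h : f = h :> (M -> R) -> f = h.
Proof. exact: val_inj. Qed.

Lemma vfieldZD X (a : R) f h : X (a *: f + h) = a *: X f + X h.
Proof. by have /set_mem[+ _] := vfieldP X; apply. Qed.

Lemma vfieldM X f h : X (f * h) = X f * h + f * X h.
Proof. by have /set_mem[_ +] := vfieldP X; apply. Qed.

Lemma vfieldD X f h : X (f + h) = X f + X h.
Proof. by have := vfieldZD X 1 f h; rewrite !scale1r. Qed.

Lemma vfield0 X : X 0 = 0.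
Proof. by apply: (addrI (X 0)); rewrite -vfieldD !addr0. Qed.

Lemma vfieldZ X (a : R) f : X (a *: f) = a *: X f.
Proof. by have := vfieldZD X a f 0; rewrite vfield0 !addr0. Qed.

Lemma vfieldN X f : X (- f) = - X f.
Proof. by rewrite -scaleN1r vfieldZ scaleN1r. Qed.

Lemma vfieldB X f h : X (f - h) = X f - X h.
Proof. by rewrite vfieldD vfieldN. Qed.

Lemma vfield_sum X (I : Type) (r : seq I) (F : I -> Cinfty M) :
  X (\sum_(i <- r) F i) = \sum_(i <- r) X (F i).
Proof.
elim: r => [|i r IHr]; first by rewrite !big_nil vfield0.
by rewrite !big_cons vfieldD IHr.
Qed.

Lemma vfield1 X : X 1 = 0.
Proof.
by apply: (addrI (X 1)); rewrite addr0 -[RHS](congr1 X (mulr1 1)) vfieldM mulr1 mul1r.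
Qed.

Lemma Cinfty_sumE (I : Type) (r : seq I) (F : I -> Cinfty M) p :
  (\sum_(i <- r) F i) p = \sum_(i <- r) F i p.
Proof.
elim: r => [|i r IHr]; first by rewrite !big_nil.
by rewrite !big_cons CinftyE IHr.
Qed.

(** If [b] is supported where [f = h], then [b * (f - h) = 0], and Leibniz'
    rule at [p] gives [b p * (X f p - X h p) = 0]. *)
Lemma vfield_local X f h p : (\forall x \near p, f x = h x) -> X f p = X h p.
Proof.
move=> fh; have := (fh : nbhs p [set x | f x = h x]); rewrite nbhsE => -[N [oN Np] NE].
have [b [K [_ KN b0 bp]]] := smooth_bump oN Np.
have E : b * (f - h) = 0.
  apply/Cinfty_eq/funext => x; rewrite !CinftyE.
  have [/KN/NE /= ->|/b0 ->] := pselect (K x); first by rewrite subrr mulr0.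
  by rewrite mul0r.
have := congr1 (fun u => X u p) E; rewrite vfield0 vfieldM !CinftyE vfieldB !CinftyE.
rewrite (NE _ Np) subrr mulr0 add0r => /eqP.
by rewrite mulf_eq0 (negPf bp) subr_eq0 => /eqP.
Qed.

Lemma segment_integral_center m (q : 'rV[R]_m) (G : 'rV[R]_m -> R) : segment_integral q 0 G q = G q.
Proof.
rewrite /segment_integral (@eq_Rintegral _ _ _ _ _ (fun=> G q)) => [|t _].
  by rewrite Rintegral_cst//= lebesgue_measure_itv /= lte_fin ltr01 sube0 mulr1.
by rewrite expr0 mul1r subrr scaler0 add0r.
Qed.

(** By Hadamard's lemma [f - f p] is, near [p], a combination of the coordinates
    [x_j - p_j] with smooth coefficients whose values at [p] are the partial
    derivatives of [f]. Multiplying by the square of a cut-off makes this an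
    identity between smooth functions on [M]; applying [X] and evaluating at [p]
    yields the formula, with components [X x_j]. *)
Theorem vfield_derive X (c : chart R n M) p : atlas c -> chart_dom c p ->
  exists v : 'rV[R]_n, forall f, X f p = 'D_v (f \o chart_inv c) (c p).
Proof.
move=> ac cp; have hc := atlas_chart _ ac.
have /nbhs_ballP[r /= r0 rB] : nbhs (c p) (chart_img c).
  by apply: open_nbhs_nbhs; split; [exact: chart_open_img|exists p].
pose U := ball (c p) r; have oU : open U by exact: ball_open.
pose O := chart_dom c `&` c @^-1` U.
have oO : open O by exact: chart_open_preimage.
have pO : O p by split=> //; exact: ballxx.
have [b [K [cK KO b0 bp]]] := smooth_bump oO pO.
pose a j x := c x 0 j - c p 0 j.
have sa j x : O x -> smooth_at (a j) x.
  move=> [cx _]; apply: smooth_atD (smooth_at_cst (- c p 0 j) x).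
  exact: smooth_at_coord.
pose ba j := SmoothFun (cutoff_smooth cK KO b0 (sa j)).
(* [X (ba j) p = b p * X x_j p], since the coordinate [a j] vanishes at [p]. *)
exists (\row_j (X (ba j) p / b p)) => f.
pose F := f \o chart_inv c.
have CF k : Ck k U F by apply: Ck_sub rB _; have := CinftyP f; rewrite inE => /(_ c ac k).
have CdF k j : Ck k U ('D_(delta_mx 0 j) F) by have [_] := CF k.+1; exact.
pose h j x := segment_integral (c p) 0 ('D_(delta_mx 0 j) F) (c x).
have sh j x : O x -> smooth_at (h j) x.
  move=> [cx Ux]; apply: (smooth_at_chart_comp (G := segment_integral (c p) 0 ('D_(delta_mx 0 j) F))) => // k.
  by exists U; split=> //; exact: Ck_segment_integral.
pose bh j := SmoothFun (cutoff_smooth cK KO b0 (sh j)).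
have E : b * (b * (f - f p *: (1 : Cinfty M))) = \sum_j ba j * bh j.
  apply/Cinfty_eq/funext => x; rewrite Cinfty_sumE !CinftyE.
  have [/KO[cx Ux]|/b0 b0x] := pselect (K x); last first.
    rewrite b0x mul0r big1// => j _.
    by rewrite !CinftyE /= !fctE /= b0x !mul0r.
  have := Hadamard (CF 1) Ux.
  rewrite /F /= !chart_cancel// mulr1 => ->.
  rewrite mulr_sumr mulr_sumr; apply: eq_bigr => j _.
  by rewrite /= ?fctE /a /h !mxE; ring.
have := congr1 (fun u => X u p) E.
rewrite vfield_sum Cinfty_sumE !vfieldM vfieldB vfieldZ vfield1 !CinftyE.
rewrite mulr1 subrr !(mulr0, add0r, subr0) => H.
have bb : b p * b p != 0 by rewrite mulf_neq0.
apply: (mulfI bb); rewrite -mulrA H derive_row_sum; last first.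
  by have [dF _] := CF 1; apply: dF; exact: ballxx.
rewrite mulr_sumr; apply: eq_bigr => j _.
rewrite vfieldM !CinftyE /= !fctE /a subrr mulr0 mul0r addr0.
rewrite /h segment_integral_center mxE -[X in _ = _ * X]/(_ * _).
by field.
Qed.

End VectorFields.

(** * Calculus in the charts of a Lie group *)

Section RowPairs.
Variable R : realType.

Lemma Ck_row_mxl k m1 m2 (u : 'rV[R]_m2) (U : set 'rV[R]_m1) : open U ->
  Ck k U (fun w => row_mx w u).
Proof.
move=> oU; apply/Ck_coord => // j; case: (splitP j) => i ji.
  rewrite (_ : j = lshift m2 i); last exact/val_inj.
  apply: (Ck_ext oU (f := coord_lin 0 i)) => [x _|]; first by rewrite row_mxEl.
  by apply: Ck_linear => //; exact: coord_continuous.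
rewrite (_ : j = rshift m1 i); last exact/val_inj.
apply: (Ck_ext oU (f := cst (u 0 i))) => [x _|]; first by rewrite row_mxEr.
exact: Ck_cst.
Qed.

Lemma Ck_row_mxr k m1 m2 (u : 'rV[R]_m1) (U : set 'rV[R]_m2) : open U ->
  Ck k U (fun w => row_mx u w).
Proof.
move=> oU; apply/Ck_coord => // j; case: (splitP j) => i ji.
  rewrite (_ : j = lshift m2 i); last exact/val_inj.
  apply: (Ck_ext oU (f := cst (u 0 i))) => [x _|]; first by rewrite row_mxEl.
  exact: Ck_cst.
rewrite (_ : j = rshift m1 i); last exact/val_inj.
apply: (Ck_ext oU (f := coord_lin 0 i)) => [x _|]; first by rewrite row_mxEr.
by apply: Ck_linear => //; exact: coord_continuous.
Qed.

(** The two difference quotients are the same. *)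
Lemma derive_row_mxl (W : normedModType R) m1 m2 (F : 'rV[R]_(m1 + m2) -> W) a u v :
  'D_v (fun w => F (row_mx w u)) a = 'D_(row_mx v 0) F (row_mx a u).
Proof.
have E (h : R) : F (row_mx (h *: v + a) u) = F (h *: row_mx v 0 + row_mx a u).
  by rewrite scale_row_mx scaler0 add_row_mx add0r.
by rewrite /derive; under eq_fun do rewrite /= E.
Qed.

Lemma derive_row_mxr (W : normedModType R) m1 m2 (F : 'rV[R]_(m1 + m2) -> W) a u v :
  'D_v (fun w => F (row_mx u w)) a = 'D_(row_mx 0 v) F (row_mx u a).
Proof.
have E (h : R) : F (row_mx u (h *: v + a)) = F (h *: row_mx 0 v + row_mx u a).
  by rewrite scale_row_mx scaler0 add_row_mx add0r.
by rewrite /derive; under eq_fun do rewrite /= E.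
Qed.

End RowPairs.

Lemma continuous_pair_at (T T1 T2 : topologicalType) (f : T -> T1) (g : T -> T2) x :
  {for x, continuous f} -> {for x, continuous g} ->
  {for x, continuous (fun y => (f y, g y))}.
Proof. by move=> cf cg; exact: cvg_pair. Qed.

Section RowDifferentiable.
Variable R : realType.

Lemma differentiable_rV (V : normedModType R) m (f : V -> 'rV[R]_m) x :
  (forall j, differentiable (fun y => f y 0 j) x) -> differentiable f x.
Proof.
move=> df; pose g j (y : V) := f y 0 j *: (delta_mx 0 j : 'rV[R]_m).
have -> : f = \sum_j g j.
  by apply/funext => y; rewrite fct_sumE [LHS]row_sum_delta.
apply: differentiable_sum => j; exact: differentiableZl.
Qed.

Lemma derive_rV (V : normedModType R) m (f : V -> 'rV[R]_m) x v j :
  differentiable f x -> 'D_v f x 0 j = 'D_v (fun y => f y 0 j) x.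
Proof. by move=> df; rewrite derive_mx ?mxE//; exact: diff_derivable. Qed.

Lemma row_mx_differentiable (V : normedModType R) m1 m2 (f : V -> 'rV[R]_m1)
    (g : V -> 'rV[R]_m2) x :
  differentiable f x -> differentiable g x ->
  differentiable (fun y => row_mx (f y) (g y)) x.
Proof.
move=> df dg; apply: differentiable_rV => j; case: (splitP j) => i ji.
  rewrite (_ : j = lshift m2 i); last exact/val_inj.
  rewrite (_ : (fun y => _) = coord_lin 0 i \o f); last by apply/funext => y; rewrite row_mxEl.
  by apply: differentiable_comp => //; exact: differentiable_coord.
rewrite (_ : j = rshift m1 i); last exact/val_inj.
rewrite (_ : (fun y => _) = coord_lin 0 i \o g); last by apply/funext => y; rewrite row_mxEr.
by apply: differentiable_comp => //; exact: differentiable_coord.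
Qed.

Lemma derive_row_mx (V : normedModType R) m1 m2 (f : V -> 'rV[R]_m1)
    (g : V -> 'rV[R]_m2) x v :
  differentiable f x -> differentiable g x ->
  'D_v (fun y => row_mx (f y) (g y)) x = row_mx ('D_v f x) ('D_v g x).
Proof.
move=> df dg; apply/rowP => j; rewrite derive_rV; last exact: row_mx_differentiable.
case: (splitP j) => i ji.
  rewrite (_ : j = lshift m2 i); last exact/val_inj.
  rewrite row_mxEl derive_rV//; congr ('D_v _ x).
  by apply/funext => y; rewrite row_mxEl.
rewrite (_ : j = rshift m1 i); last exact/val_inj.
rewrite row_mxEr derive_rV//; congr ('D_v _ x).
by apply/funext => y; rewrite row_mxEr.
Qed.

End RowDifferentiable.

Section LieGroupCalculus.
Variables (R : realType) (n : nat) (G : lieGroupType R n).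
Implicit Types (x y a : G) (f : G -> R).

(** The function [(x, y) |-> f (x y)] read in the charts [c] and [d]. *)
Definition mul_in_charts f (c d : chart R n G) (v : 'rV[R]_(n + n)) : R :=
  f (chart_inv c (lsubmx v) * chart_inv d (rsubmx v))%g.

Lemma mul_in_charts_smooth f (c d : chart R n G) x y : atlas c -> atlas d ->
  chart_dom c x -> chart_dom d y -> smooth_at f (x * y)%g ->
  forall k, exists W, [/\ open W, W (row_mx (c x) (d y)) & Ck k W (mul_in_charts f c d)].
Proof.
move=> ac ad cx dy sf k; have [hc hd] := (atlas_chart _ ac, atlas_chart _ ad).
have [e ae exy] := atlas_cover (x * y)%g; have he := atlas_chart _ ae.
have [We [oWe Wxy _ fWe]] := smooth_at_chart sf ae exy k.
pose A := lsubmx @^-1` chart_img c `&` (rsubmx @^-1` chart_img d) : set 'rV[R]_(n + n).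
have oA : open A.
  apply: openI; apply: open_comp; try exact: chart_open_img.
    by move=> v _; exact: continuous_lsubmx.
  by move=> v _; exact: continuous_rsubmx.
pose m (v : 'rV[R]_(n + n)) := (chart_inv c (lsubmx v) * chart_inv d (rsubmx v))%g.
have cm v : A v -> {for v, continuous m}.
  move=> [/= cv dv].
  apply: (@continuous_comp _ _ _ (fun v => (chart_inv c (lsubmx v), chart_inv d (rsubmx v)))
     (fun xy : G * G => (xy.1 * xy.2)%g)); last exact: lie_mul_continuous.
  apply: continuous_pair_at.
    apply: (@continuous_comp _ _ _ lsubmx (chart_inv c)); first exact: continuous_lsubmx.
    by have [_ _ _ _] := hc; apply.
  apply: (@continuous_comp _ _ _ rsubmx (chart_inv d)); first exact: continuous_rsubmx.
  by have [_ _ _ _] := hd; apply.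
pose B := chart_dom e `&` e @^-1` We.
have oB : open B by exact: chart_open_preimage.
have oW : open (A `&` m @^-1` B) by exact: open_preimage_on.
exists (A `&` m @^-1` B); split=> //.
  by split; rewrite /A /m /= !row_mxKl !row_mxKr; [split; [exists x|exists y]|rewrite !chart_cancel].
have Cm : Ck k (A `&` m @^-1` B) (e \o m).
  by apply: Ck_sub (lie_mul_smooth _ _ _ ac ad ae k) => v [[cv dv] [ev _]].
have sub v : (A `&` m @^-1` B) v -> We ((e \o m) v) by move=> [_ []].
apply: (Ck_ext oW _ (Ck_comp_real oW oWe sub Cm fWe)) => v [_ [ev _]].
by rewrite /= chart_cancel.
Qed.

(** Freeze the first argument of [mul_in_charts]. *)
Lemma smooth_at_mulL f a x : smooth_at f (a * x)%g ->
  smooth_at (fun y => f (a * y)%g) x.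
Proof.
move=> sf; have [c ac ca] := atlas_cover a; have [d ad dx] := atlas_cover x.
exists d => // k; have hc := atlas_chart _ ac.
have [W [oW Wx CW]] := mul_in_charts_smooth ac ad ca dx sf k.
pose r (w : 'rV[R]_n) := row_mx (c a) w.
have cr w : {for w, continuous r} by apply: (Ck_row_mxr 0 (c a) openT w I).
have oW' : open (r @^-1` W) by apply: open_comp => // w _; exact: cr.
exists (r @^-1` W); split=> //.
have sub w : (r @^-1` W) w -> W (r w) by [].
apply: (Ck_ext oW' _ (Ck_comp_real oW' oW sub (Ck_row_mxr k (c a) oW') CW)) => w _.
by rewrite /= /mul_in_charts /r row_mxKl row_mxKr chart_cancel.
Qed.

Lemma smooth_at_mulR f a x : smooth_at f (x * a)%g ->
  smooth_at (fun y => f (y * a)%g) x.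
Proof.
move=> sf; have [c ac ca] := atlas_cover a; have [d ad dx] := atlas_cover x.
exists d => // k; have hc := atlas_chart _ ac.
have [W [oW Wx CW]] := mul_in_charts_smooth ad ac dx ca sf k.
pose r (w : 'rV[R]_n) := row_mx w (c a).
have cr w : {for w, continuous r} by apply: (Ck_row_mxl 0 (c a) openT w I).
have oW' : open (r @^-1` W) by apply: open_comp => // w _; exact: cr.
exists (r @^-1` W); split=> //.
have sub w : (r @^-1` W) w -> W (r w) by [].
apply: (Ck_ext oW' _ (Ck_comp_real oW' oW sub (Ck_row_mxl k (c a) oW') CW)) => w _.
by rewrite /= /mul_in_charts /r row_mxKl row_mxKr chart_cancel.
Qed.

Fact ltrans_subproof a (f : Cinfty G) : (fun y => f (a * y)%g) \in smooth_fun G.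
Proof. by apply/smooth_funP => x; apply: smooth_at_mulL; exact: Cinfty_smooth_at. Qed.

Fact rtrans_subproof a (f : Cinfty G) : (fun y => f (y * a)%g) \in smooth_fun G.
Proof. by apply/smooth_funP => x; apply: smooth_at_mulR; exact: Cinfty_smooth_at. Qed.

Definition ltrans a (f : Cinfty G) : Cinfty G := SmoothFun (ltrans_subproof a f).
Definition rtrans a (f : Cinfty G) : Cinfty G := SmoothFun (rtrans_subproof a f).

Lemma left_invariantP (X : vfield G) :
  left_invariant_vf X <-> forall a (f : Cinfty G), X (ltrans a f) = ltrans a (X f).
Proof.
split=> [lX a f|lX a f h hE]; first exact/Cinfty_eq/lX.
have -> : h = ltrans a f by exact: Cinfty_eq.
by rewrite lX.
Qed.

Lemma smooth_at_differentiable f x (c : chart R n G) : smooth_at f x ->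
  atlas c -> chart_dom c x -> differentiable (f \o chart_inv c) (c x).
Proof.
move=> sf ac cx; have [W [oW Wx _ [dF _]]] := smooth_at_chart sf ac cx 1.
exact: dF.
Qed.

(** A tangent vector at the identity sends a product of two maps fixing the
    identity to the sum of its values, because the differential of the
    multiplication at the identity is the addition. The product itself enters
    only through the functional [delta] (the directional derivative defining [X]
    in a chart), so that its global smoothness need not be established. *)
Lemma derivation_product (X : vfield G) : exists delta : (G -> R) -> R,
  forall (phi psi : G -> G) (h1 h2 h : Cinfty G),
  {for 1%g, continuous phi} -> {for 1%g, continuous psi} ->
  (forall f, smooth_at f (phi 1%g) -> smooth_at (f \o phi) 1%g) ->
  (forall f, smooth_at f (psi 1%g) -> smooth_at (f \o psi) 1%g) ->
  phi 1%g = 1%g -> psi 1%g = 1%g ->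
  (forall y, h1 y = h (phi y)) -> (forall y, h2 y = h (psi y)) ->
  delta (fun y => h (phi y * psi y)%g) = X h1 1%g + X h2 1%g.
Proof.
have [c ac c1] := atlas_cover (1%g : G); have hc := atlas_chart _ ac.
have [v vP] := vfield_derive X ac c1.
exists (fun k => 'D_v (k \o chart_inv c) (c 1%g)).
move=> phi psi h1 h2 h cphi cpsi sphi spsi phi1 psi1 h1E h2E; rewrite !vP.
pose hat (th : G -> G) := c \o th \o chart_inv c.
have dhat (th : G -> G) : th 1%g = 1%g ->
    (forall f, smooth_at f (th 1%g) -> smooth_at (f \o th) 1%g) ->
    differentiable (hat th) (c 1%g).
  move=> th1 sth; apply: differentiable_rV => j.
  apply: (smooth_at_differentiable (f := (fun x => c x 0 j) \o th)) => //.
  by apply: sth; rewrite th1; exact: smooth_at_coord.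
have nearc (th : G -> G) : th 1%g = 1%g -> {for 1%g, continuous th} ->
    \forall w \near c 1%g, chart_dom c (th (chart_inv c w)).
  move=> th1 cth; have [oD _ _ _ cI] := hc.
  have cc : {for c 1%g, continuous (th \o chart_inv c)}.
    apply: continuous_comp; first by apply: cI; exists 1%g.
    by rewrite chart_cancel.
  by apply: (cc (chart_dom c)); apply: open_nbhs_nbhs; rewrite /= chart_cancel// th1.
have [np ns] := (nearc _ phi1 cphi, nearc _ psi1 cpsi).
have [dp ds] := (dhat _ phi1 sphi, dhat _ psi1 spsi).
have [hp1 hs1] : hat phi (c 1%g) = c 1%g /\ hat psi (c 1%g) = c 1%g.
  by rewrite /hat /= chart_cancel// phi1 psi1.
pose H := mul_in_charts h c c.
have [W [oW W1 CW]] := mul_in_charts_smooth ac ac c1 c1 (Cinfty_smooth_at h (1 * 1)%g) 1.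
have dH : differentiable H (row_mx (c 1%g) (c 1%g)) by have [dH _] := CW; exact: dH.
have oneid : row_mx (hat phi (c 1%g)) (hat psi (c 1%g)) = row_mx (c 1%g) (c 1%g) by rewrite hp1 hs1.
have -> : 'D_v ((fun y => h (phi y * psi y)%g) \o chart_inv c) (c 1%g) =
    'D_v (H \o (fun w => row_mx (hat phi w) (hat psi w))) (c 1%g).
  apply: near_eq_derive; move: np ns; apply: filterS2 => w pw sw.
  by rewrite /H /mul_in_charts /hat /= row_mxKl row_mxKr !chart_cancel.
have dpair := row_mx_differentiable dp ds.
rewrite derive_comp//; last by rewrite oneid.
rewrite oneid (derive_row_mx _ dp ds).
have -> : 'D_v (h1 \o chart_inv c) (c 1%g) =
    'D_v ((fun u => H (row_mx u (c 1%g))) \o hat phi) (c 1%g).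
  apply: near_eq_derive; move: np; apply: filterS => w pw.
  by rewrite /H /mul_in_charts /hat /= row_mxKl row_mxKr !chart_cancel// h1E mulg1.
have -> : 'D_v (h2 \o chart_inv c) (c 1%g) =
    'D_v ((fun u => H (row_mx (c 1%g) u)) \o hat psi) (c 1%g).
  apply: near_eq_derive; move: ns; apply: filterS => w pw.
  by rewrite /H /mul_in_charts /hat /= row_mxKl row_mxKr !chart_cancel// h2E mul1g.
have dl : differentiable (fun w : 'rV[R]_n => row_mx w (c 1%g)) (c 1%g).
  by apply: row_mx_differentiable; [exact: ex_diff|exact: differentiable_cst].
have dr : differentiable (fun w : 'rV[R]_n => row_mx (c 1%g) w) (c 1%g).
  by apply: row_mx_differentiable; [exact: differentiable_cst|exact: ex_diff].
have dHl : differentiable (fun u => H (row_mx u (c 1%g))) (hat phi (c 1%g)).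
  by rewrite hp1; exact: (differentiable_comp dl dH).
have dHr : differentiable (fun u => H (row_mx (c 1%g) u)) (hat psi (c 1%g)).
  by rewrite hs1; exact: (differentiable_comp dr dH).
rewrite (derive_comp v dp dHl) (derive_comp v ds dHr).
rewrite hp1 hs1 derive_row_mxl derive_row_mxr !deriveE// -linearD /= add_row_mx.
by rewrite addr0 add0r.
Qed.

End LieGroupCalculus.

(** * In a two-step nilpotent group, brackets of left-invariant fields are central *)

Section VfieldAlgebra.
Variables (R : realType) (n : nat) (M : manifoldType R n).
Implicit Types (X Y Z : vfield M) (f : Cinfty M).

Lemma vfield_eq X Y : (forall f, X f = Y f) -> X = Y.
Proof. by move=> XY; apply/val_inj/funext. Qed.

Lemma vfield_addE X Y f : (X + Y) f = X f + Y f. Proof. by []. Qed.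
Lemma vfield_oppE X f : (- X) f = - X f. Proof. by []. Qed.
Lemma vfield_zeroE f : (0 : vfield M) f = 0. Proof. by []. Qed.
Lemma lie_bracketE X Y f : lie_bracket X Y f = X (Y f) - Y (X f). Proof. by []. Qed.

Lemma lie_bracketC X Y : lie_bracket Y X = - lie_bracket X Y.
Proof. by apply: vfield_eq => f; rewrite vfield_oppE !lie_bracketE opprB. Qed.

Lemma lie_bracketDl X Y Z : lie_bracket (X + Y) Z = lie_bracket X Z + lie_bracket Y Z.
Proof.
by apply: vfield_eq => f; rewrite vfield_addE !lie_bracketE !vfield_addE vfieldD opprD addrACA.
Qed.

Lemma lie_bracketDr X Y Z : lie_bracket Z (X + Y) = lie_bracket Z X + lie_bracket Z Y.
Proof. by rewrite -[LHS]opprK -lie_bracketC lie_bracketDl opprD -!lie_bracketC. Qed.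

End VfieldAlgebra.

Section TwoStep.
Variables (R : realType) (n : nat) (G : lieGroupType R n).
Implicit Types (X Y Z W : vfield G) (f : Cinfty G) (a x y : G).

Definition right_invariant_vf X := forall a f, X (rtrans a f) = rtrans a (X f).

Lemma ltransE a f x : ltrans a f x = f (a * x)%g. Proof. by []. Qed.
Lemma rtransE a f x : rtrans a f x = f (x * a)%g. Proof. by []. Qed.

Lemma rtrans_rtrans a b f : rtrans a (rtrans b f) = rtrans (a * b)%g f.
Proof. by apply/Cinfty_eq/funext => x; rewrite !rtransE mulgA. Qed.

Lemma rtrans1 f : rtrans 1%g f = f.
Proof. by apply/Cinfty_eq/funext => x; rewrite rtransE mulg1. Qed.

Lemma ltrans_rtrans a b f : ltrans a (rtrans b f) = rtrans b (ltrans a f).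
Proof. by apply/Cinfty_eq/funext => x; rewrite !ltransE !rtransE ltransE mulgA. Qed.

Lemma rtransD a f h : rtrans a (f + h) = rtrans a f + rtrans a h. Proof. exact/Cinfty_eq. Qed.
Lemma rtransZ a (r : R) f : rtrans a (r *: f) = r *: rtrans a f. Proof. exact/Cinfty_eq. Qed.
Lemma rtransM a f h : rtrans a (f * h) = rtrans a f * rtrans a h. Proof. exact/Cinfty_eq. Qed.
Lemma rtransN a f : rtrans a (- f) = - rtrans a f. Proof. exact/Cinfty_eq. Qed.

Lemma left_invariant_at X x f : left_invariant_vf X -> X f x = X (ltrans x f) 1%g.
Proof. by move=> /left_invariantP ->; rewrite ltransE mulg1. Qed.

Lemma left_invariant_bracket X Y : left_invariant_vf X -> left_invariant_vf Y ->
  left_invariant_vf (lie_bracket X Y).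
Proof.
move=> /left_invariantP lX /left_invariantP lY; apply/left_invariantP => a f.
by rewrite !lie_bracketE lY lX lX lY; exact/Cinfty_eq.
Qed.

(** For a field that commutes with right translations and one that commutes with
    left translations, the two compositions at the identity are the mixed second
    derivatives, in the two orders, of [(x, y) |-> f (x y)]. *)
Lemma left_right_invariant_commute W Z : left_invariant_vf W -> right_invariant_vf W ->
  left_invariant_vf Z -> lie_bracket W Z = 0.
Proof.
move=> lW rW lZ; apply: vfield_eq => f; apply/Cinfty_eq/funext => x.
rewrite (left_invariant_at _ _ (left_invariant_bracket lW lZ)).
rewrite vfield_zeroE Cinfty0E; move: (ltrans x f) => {x}f.
rewrite lie_bracketE !CinftyE.
have [c ac c1] := atlas_cover (1%g : G); have hc := atlas_chart _ ac.
have [[w wP] [z zP]] := (vfield_derive W ac c1, vfield_derive Z ac c1).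
pose F := mul_in_charts f c c.
have [V [oV V1 CV]] := mul_in_charts_smooth ac ac c1 c1 (Cinfty_smooth_at f (1 * 1)%g) 2.
have nearc : \forall u \near c 1%g, chart_dom c (chart_inv c u).
  have : nbhs (c 1%g) (chart_img c).
    by apply: open_nbhs_nbhs; split; [exact: chart_open_img|exists 1%g].
  by apply: filterS => u /(chart_invP hc)[].
have -> : W (Z f) 1%g = 'D_(row_mx w 0) ('D_(row_mx 0 z) F) (row_mx (c 1%g) (c 1%g)).
  rewrite wP -(derive_row_mxl ('D_(row_mx 0 z) F)); apply: near_eq_derive.
  apply: filterS nearc => u cu; rewrite /= (left_invariant_at _ _ lZ) zP.
  rewrite -derive_row_mxr; congr ('D_z _ (c 1%g)); apply/funext => u'.
  by rewrite /F /mul_in_charts /= row_mxKl row_mxKr.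
have -> : Z (W f) 1%g = 'D_(row_mx 0 z) ('D_(row_mx w 0) F) (row_mx (c 1%g) (c 1%g)).
  rewrite zP -(derive_row_mxr ('D_(row_mx w 0) F)); apply: near_eq_derive.
  apply: filterS nearc => u cu; rewrite /=.
  rewrite -[chart_inv c u]mul1g -rtransE -rW wP.
  rewrite -derive_row_mxl; congr ('D_w _ (c 1%g)); apply/funext => u'.
  by rewrite /F /mul_in_charts /= row_mxKl row_mxKr.
by rewrite (derive_swap _ _ oV V1 CV) subrr.
Qed.

Lemma mulL_continuous a : continuous (fun y : G => a * y)%g.
Proof.
move=> x; apply: (@continuous_comp _ _ _ (fun y => (a, y)) (fun xy : G * G => (xy.1 * xy.2)%g)).
  by apply: continuous_pair_at; [exact: cst_continuous|exact: cvg_id].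
exact: lie_mul_continuous.
Qed.

Lemma mulR_continuous a : continuous (fun y : G => y * a)%g.
Proof.
move=> x; apply: (@continuous_comp _ _ _ (fun y => (y, a)) (fun xy : G * G => (xy.1 * xy.2)%g)).
  by apply: continuous_pair_at; [exact: cvg_id|exact: cst_continuous].
exact: lie_mul_continuous.
Qed.

Fact adjoint_subproof a X :
  (fun f => rtrans a^-1%g (X (rtrans a f)) : (Cinfty G)^o) \in is_derivation G.
Proof.
have rtransK f : rtrans a^-1%g (rtrans a f) = f by rewrite rtrans_rtrans mulVg rtrans1.
rewrite inE; split=> [r f h|f h].
  by rewrite rtransD rtransZ vfieldZD rtransD rtransZ.
by rewrite rtransM vfieldM rtransD !rtransM !rtransK.
Qed.

(** The transport of [X] by right translation, hence Ad(a) X or Ad(a^-1) X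
    according to conventions. *)
Definition adjoint a X : vfield G := VField (adjoint_subproof a X).

Lemma adjoint_def a X f : adjoint a X f = rtrans a^-1%g (X (rtrans a f)).
Proof. by []. Qed.

Lemma adjointE a X f : X (rtrans a f) = rtrans a (adjoint a X f).
Proof. by rewrite adjoint_def rtrans_rtrans mulgV rtrans1. Qed.

Lemma adjoint_bracket a X Y :
  adjoint a (lie_bracket X Y) = lie_bracket (adjoint a X) (adjoint a Y).
Proof.
apply: vfield_eq => f; rewrite adjoint_def !lie_bracketE.
have E (U V : vfield G) : U (V (rtrans a f)) = rtrans a (adjoint a U (adjoint a V f)).
  by rewrite (adjointE a V) (adjointE a U).
by rewrite !E -rtransN -rtransD rtrans_rtrans mulVg rtrans1.
Qed.

Lemma adjoint_left_invariant a X : left_invariant_vf X -> left_invariant_vf (adjoint a X).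
Proof.
move=> /left_invariantP lX; apply/left_invariantP => b f.
by rewrite !adjoint_def -ltrans_rtrans lX ltrans_rtrans.
Qed.

Hypothesis nil2 : forall x y z : G, commute (commg x y) z.

(** With [y ^ a = y [y, a]] this says that [y, a c] = [y, a] [y, c] when
    commutators are central; infinitesimally, (Ad(a) - 1)(Ad(c) - 1) = 0. The
    form chosen here involves no inverse, which suits [derivation_product]. *)
Lemma conjg_two_step y a c :
  (conjg y (a * c) * y)%g = (conjg y a * conjg y c)%g.
Proof.
have cE (z b : G) : conjg z b = (z * commg z b)%g by rewrite commgEl mulVKg.
have kJ b z : conjg (commg y b) z = commg y b.
  by apply/conjg_fixP/commgP; exact: nil2.
rewrite conjgM (cE y a) conjMg kJ (cE y c).
have := nil2 y c (commg y a * y)%g; rewrite /commute.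
by move: (commg y c) (commg y a) => m k mk; rewrite -!mulgA mk -mulgA.
Qed.

(** The infinitesimal form of [conjg_two_step]: the two sides of that identity
    are products, on which [derivation_product] evaluates [X]. *)
Lemma adjoint_sub_right_invariant a X : left_invariant_vf X ->
  right_invariant_vf (adjoint a X - X).
Proof.
move=> lX c f; apply/Cinfty_eq/funext => x.
have adE b h z : adjoint b X h z = X (ltrans b^-1%g (rtrans b (ltrans z h))) 1%g.
  rewrite adjoint_def rtransE (left_invariant_at _ _ lX); congr (X _ 1%g).
  by apply/Cinfty_eq/funext => y; rewrite !ltransE !rtransE !ltransE -!mulgA.
rewrite rtransE !vfield_addE !vfield_oppE !CinftyE !adE.
rewrite (left_invariant_at x _ lX) (left_invariant_at (x * c)%g _ lX).
set F := ltrans (x * c)%g f.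
pose C b := ltrans b^-1%g (rtrans b F).
have -> : ltrans a^-1%g (rtrans a (ltrans x (rtrans c f))) = C (a * c)%g.
  apply/Cinfty_eq/funext => y; rewrite /C !ltransE !rtransE !ltransE !rtransE; congr (f _).
  by rewrite invgM !mulgA mulgK.
have -> : ltrans x (rtrans c f) = C c.
  apply/Cinfty_eq/funext => y; rewrite /C !ltransE !rtransE !ltransE; congr (f _).
  by rewrite !mulgA mulgK.
have CE b y : C b y = F (conjg y b) by rewrite /C ltransE rtransE conjgE !mulgA.
have smJ b (g : G -> R) : smooth_at g (conjg 1%g b) ->
    smooth_at (g \o (fun y => conjg y b)) 1%g.
  move=> sg; apply: (smooth_at_mulR (f := fun z => g (b^-1 * z)%g)).
  exact: smooth_at_mulL.
have ctJ b : {for 1%g, continuous (fun y : G => conjg y b)}.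
  apply: (@continuous_comp _ _ _ (fun y => y * b)%g (fun z => b^-1 * z)%g).
    exact: mulR_continuous.
  exact: mulL_continuous.
have [delta dP] := derivation_product X.
have J1 b : conjg (1%g : G) b = 1%g by rewrite conj1g.
have idc : {for 1%g, continuous (id : G -> G)} by exact: cvg_id.
have E1 := dP (fun y => conjg y (a * c)) id (C (a * c)%g) F F (ctJ _) idc (smJ _)
  (fun g sg => sg) (J1 _) erefl (CE _) (fun=> erefl).
have E2 := dP (fun y => conjg y a) (fun y => conjg y c) (C a) (C c) F (ctJ _) (ctJ _) (smJ _) (smJ _) (J1 _) (J1 _) (CE _) (CE _).
have E : X (C (a * c)%g) 1%g + X F 1%g = X (C a) 1%g + X (C c) 1%g.
  rewrite -E2 -E1.
  by congr delta; apply/funext => y; rewrite conjg_two_step.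
by rewrite -/(C a); move: E => /eqP; rewrite addrC -subr_eq => /eqP <-; ring.
Qed.

(** [adjoint a] changes [X] and [Y] by right-invariant fields, which commute with
    all left-invariant ones, so it fixes [[X, Y]]. Thus [[X, Y]] is
    right-invariant too, hence central. *)
Lemma bracket_central X Y Z : left_invariant_vf X -> left_invariant_vf Y ->
  left_invariant_vf Z -> lie_bracket (lie_bracket X Y) Z = 0.
Proof.
move=> lX lY lZ; apply: left_right_invariant_commute => //.
  exact: left_invariant_bracket.
move=> a f; rewrite adjointE adjoint_bracket.
have lA U : left_invariant_vf U -> left_invariant_vf (adjoint a U - U).
  move=> lU; apply/left_invariantP => b h.
  rewrite !vfield_addE !vfield_oppE ((left_invariantP _).1 (adjoint_left_invariant a lU)).
  by rewrite ((left_invariantP _).1 lU); exact/Cinfty_eq.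
have AE U : adjoint a U = U + (adjoint a U - U) by rewrite addrC subrK.
have cA U V : left_invariant_vf U -> left_invariant_vf V ->
    lie_bracket (adjoint a U - U) V = 0.
  move=> lU lV; apply: left_right_invariant_commute => //; first exact: lA.
  exact: adjoint_sub_right_invariant.
have c1 := cA X Y lX lY.
have c2 := cA X (adjoint a Y - Y) lX (lA Y lY).
have c3 := cA Y X lY lX.
rewrite (AE X) (AE Y).
move: (adjoint a X - X) (adjoint a Y - Y) c1 c2 c3 => dX dY c1 c2 c3.
rewrite lie_bracketDl !lie_bracketDr c1 c2 (lie_bracketC dY) c3.
by rewrite oppr0 !addr0.
Qed.

End TwoStep.

(** * Averaging on a two-step nilpotent group *)

Section Amenability.
Variables (R : realType) (G : groupType).
Implicit Types (F u c : G -> R) (a b x y z : G).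

Definition bounded_fct F := exists C, forall x, `|F x| <= C.

Definition central z := forall x, commute z x.

(** The index counts the terms. It is what inductions are carried on, since
    averaging preserves the number of terms but changes the functions. *)
Inductive central_coboundary : nat -> (G -> R) -> Prop :=
| CentralCoboundary0 : central_coboundary 0 (fun=> 0)
| CentralCoboundaryS m c z F : central z -> bounded_fct F -> central_coboundary m c ->
    central_coboundary m.+1 (fun x => F (x * z)%g - F x + c x).

Inductive coboundary : nat -> (G -> R) -> Prop :=
| Coboundary0 m c : central_coboundary m c -> coboundary 0 c
| CoboundaryS m u b F : bounded_fct F -> coboundary m u ->
    coboundary m.+1 (fun x => F (x * b)%g - F x + u x).

Definition avg b (k : nat) F x := k.+1%:R^-1 * \sum_(0 <= j < k.+1) F (x * b ^+ j)%g.

Lemma avg_bounded b k F : bounded_fct F -> bounded_fct (avg b k F).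
Proof.
move=> [C FC]; exists C => x; rewrite /avg normrM ger0_norm ?invr_ge0//.
rewrite mulrC ler_pdivrMr ?ltr0n//; apply: le_trans (ler_norm_sum _ _ _) _.
apply: le_trans (ler_sum _ (fun j _ => FC _)) _.
by rewrite sumr_const_nat subn0 mulr_natr.
Qed.

Lemma avgD b k F u : avg b k (fun x => F x + u x) = (fun x => avg b k F x + avg b k u x).
Proof. by apply/funext => x; rewrite /avg big_split /= mulrDr. Qed.

Lemma avg_ge b k u (d : R) : (forall x, d <= u x) -> forall x, d <= avg b k u x.
Proof.
move=> du x; rewrite /avg mulrC ler_pdivlMr ?ltr0n//.
apply: le_trans (ler_sum _ (fun j _ => du _)).
by rewrite sumr_const_nat subn0 mulr_natr.
Qed.

(** The sum telescopes, leaving two values of [F] divided by the number of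
    terms. *)
Lemma avg_diff_small b F (e : R) : bounded_fct F -> 0 < e ->
  exists k, forall x, avg b k (fun y => F (y * b)%g - F y) x <= e.
Proof.
move=> [C FC] e0; exists (Num.truncn ((C + C) / e)) => x.
set k := Num.truncn _.
have -> : avg b k (fun y => F (y * b)%g - F y) x = k.+1%:R^-1 * (F (x * b ^+ k.+1)%g - F x).
  rewrite /avg; congr (_ * _).
  have := telescope_sumr (fun j => F (x * b ^+ j)%g) (leq0n k.+1).
  rewrite /= expg0 mulg1 => <-.
  by apply: eq_bigr => j _; rewrite expgSr mulgA.
rewrite mulrC ler_pdivrMr ?ltr0n//.
apply: (@le_trans _ _ (C + C)).
  by apply: le_trans (ler_norm _) _; apply: le_trans (ler_normB _ _) _; rewrite lerD.
rewrite mulrC -ler_pdivrMr//; apply: ltW; exact: truncnS_gt.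
Qed.

Lemma central_coboundary_eq m c c' : c =1 c' -> central_coboundary m c -> central_coboundary m c'.
Proof. by move=> /funext ->. Qed.

Lemma coboundary_eq m c c' : c =1 c' -> coboundary m c -> coboundary m c'.
Proof. by move=> /funext ->. Qed.

Lemma central_coboundaryD m k c d : central_coboundary m c -> central_coboundary k d -> central_coboundary (m + k) (fun x => c x + d x).
Proof.
move=> + dk; elim=> [|{}m {}c z F zc bF _ IH].
  by apply: central_coboundary_eq dk => x; rewrite add0r.
by rewrite addSn; apply: central_coboundary_eq (CentralCoboundaryS zc bF IH) => x; rewrite addrA.
Qed.

Lemma coboundaryD_central m k u c : coboundary m u -> central_coboundary k c -> coboundary m (fun x => u x + c x).
Proof.
move=> + ck; elim=> [j d dj|{}m {}u b F bF _ IH].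
  exact: Coboundary0 (central_coboundaryD dj ck).
by apply: coboundary_eq (CoboundaryS b bF IH) => x; rewrite addrA.
Qed.

Lemma avg_central b k z F : central z ->
  avg b k (fun x => F (x * z)%g - F x) = (fun x => avg b k F (x * z)%g - avg b k F x).
Proof.
move=> zc; apply/funext => x; rewrite /avg -mulrBr -sumrB; congr (_ * _).
by apply: eq_bigr => j _; rewrite -!mulgA (zc (b ^+ j)%g).
Qed.

Lemma central_coboundary_avg b k m c : central_coboundary m c -> central_coboundary m (avg b k c).
Proof.
elim=> [|{}m {}c z F zc bF _ IH].
  by apply: central_coboundary_eq CentralCoboundary0 => x; rewrite /avg big1 ?mulr0.
by rewrite avgD avg_central//; apply: CentralCoboundaryS => //; exact: avg_bounded.
Qed.

(** Averaging over the powers of the last translation makes its term small and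
    turns the other terms into terms of the same kind, as translations by
    central elements commute with everything. *)
Lemma central_coboundary_not_ge m c (d : R) : central_coboundary m c -> 0 < d -> ~ forall x, d <= c x.
Proof.
elim: m c d => [|m IHm] c d cm d0 dc.
  inversion cm as [E|]; subst.
  by have := dc 1%g; rewrite leNgt d0.
inversion cm as [|m' c' z F zc bF cm' Em Ec]; subst.
have d2 : 0 < d / 2 by rewrite divr_gt0.
have [k kP] := avg_diff_small z bF d2.
apply: (IHm _ _ (central_coboundary_avg z k cm') d2) => x.
have := avg_ge z k dc x; rewrite avgD => H.
by have := kP x; lra.
Qed.

Hypothesis nil2 : forall x y z : G, commute (commg x y) z.

(** Moving the translation by [a] through those by the powers [b ^+ j] costs the
    commutators [b ^+ j, a], which are central; so the averaged coboundary is
    again a coboundary, up to a central one. *)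
Lemma avg_twist b k a F : bounded_fct F -> exists m c, central_coboundary m c /\
  avg b k (fun x => F (x * a)%g - F x) =1
  (fun x => (avg b k F (x * a)%g - avg b k F x) + c x).
Proof.
move=> bF; pose H j y := k.+1%:R^-1 * F (y * (a * b ^+ j))%g.
pose c x := \sum_(0 <= j < k.+1) (H j (x * commg (b ^+ j) a)%g - H j x).
have bH j : bounded_fct (H j).
  have [C FC] := bF; exists (k.+1%:R^-1 * C) => x; rewrite /H normrM ger0_norm ?invr_ge0//.
  by rewrite ler_wpM2l ?invr_ge0.
exists k.+1, c; split.
  rewrite /c; elim: k.+1 => [|m IHm].
    by apply: central_coboundary_eq CentralCoboundary0 => x; rewrite big_geq.
  apply: central_coboundary_eq (CentralCoboundaryS (z := commg (b ^+ m) a) _ (bH m) IHm) => [x|]; last exact: nil2.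
  by rewrite big_nat_recr //= addrC.
move=> x; rewrite /= /avg /c /H -mulrBr -sumrB.
under [X in _ + X]eq_bigr do rewrite -mulrBr.
rewrite -mulr_sumr -mulrDr -big_split /=; congr (_ * _); apply: eq_bigr => j _.
have -> : (x * commg (b ^+ j) a * (a * b ^+ j) = x * b ^+ j * a)%g.
  rewrite -mulgA (nil2 _ _ (a * b ^+ j)%g) -commgC -?mulgA.
  by rewrite commgC -!mulgA.
by rewrite -!mulgA; ring.
Qed.

Lemma coboundary_avg b k m u : coboundary m u -> coboundary m (avg b k u).
Proof.
elim=> [j c cj|{}m {}u a F bF _ IH]; first exact: Coboundary0 (central_coboundary_avg b k cj).
rewrite avgD; have [j [c [cj cE]]] := avg_twist b k a bF.
apply: coboundary_eq (CoboundaryS a (avg_bounded b k bF) (coboundaryD_central IH cj)) => x.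
by rewrite cE; ring.
Qed.

(** The argument of [central_coboundary_not_ge], with the central terms produced
    by [avg_twist] accumulating in the remainder. *)
Theorem coboundary_not_ge m u (d : R) : coboundary m u -> 0 < d -> ~ forall x, d <= u x.
Proof.
elim: m u d => [|m IHm] u d um d0 du.
  inversion um as [j c cj Em Ec|]; subst; exact: (central_coboundary_not_ge cj d0).
inversion um as [|m' u' b F bF um' Em Eu]; subst.
have d2 : 0 < d / 2 by rewrite divr_gt0.
have [k kP] := avg_diff_small b bF d2.
apply: (IHm _ _ (coboundary_avg b k um') d2) => x.
have := avg_ge b k du x; rewrite avgD => H.
by have := kP x; lra.
Qed.

End Amenability.

(** * Left-invariant fields on a quotient *)

Section SmoothMaps.
Variable R : realType.

Lemma smooth_at_comp_map (n m : nat) (M : manifoldType R n) (N : manifoldType R m)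
    (V : set M) (F : M -> N) (f : N -> R) p :
  open V -> V p -> smooth_map_on V F -> smooth_at f (F p) -> smooth_at (f \o F) p.
Proof.
move=> oV Vp [cF sF] sf; have [c ac cp] := atlas_cover p; have [d ad dFp] := atlas_cover (F p).
have [hc hd] := (atlas_chart _ ac, atlas_chart _ ad).
exists c => // k; have [W [oW Wp WI CW]] := smooth_at_chart sf ad dFp k.
pose B := chart_dom d `&` d @^-1` W.
have oB : open B by exact: chart_open_preimage.
have oA : open (V `&` F @^-1` B) by exact: open_preimage_on.
have oS := chart_open_image hc oA.
exists (c @` (chart_dom c `&` (V `&` F @^-1` B))); split=> //.
  by exists p.
have Ct : Ck k (c @` (chart_dom c `&` (V `&` F @^-1` B))) (d \o F \o chart_inv c).
  by apply: Ck_sub (sF c d ac ad k) => _ [q [cq [Vq [dq _]]] <-]; exists q.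
have sub w : (c @` (chart_dom c `&` (V `&` F @^-1` B))) w -> W ((d \o F \o chart_inv c) w).
  by move=> [q [cq [Vq [dq Wq]]] <-]; rewrite /= chart_cancel.
apply: (Ck_ext oS _ (Ck_comp_real oS oW sub Ct CW)) => _ [q [cq [Vq [dq Wq]]] <-].
by rewrite /= (chart_cancel hc)// (chart_cancel hd).
Qed.

End SmoothMaps.

Section Quotient.
Variables (R : realType) (n : nat) (G : lieGroupType R n) (Gamma : set G).
Variables (M : manifoldType R n) (pi : G -> M).
Hypothesis quo : is_left_quotient Gamma pi.
Implicit Types (X Y : vfield G) (f : Cinfty M) (x y a : G) (q : M).

Lemma pi_surj q : exists x, pi x = q.
Proof. by have [+ _ _] := quo; apply. Qed.

Lemma pi_fibre x y : pi x = pi y <-> Gamma (y * x^-1)%g.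
Proof. by have [_ + _] := quo; apply. Qed.

Lemma pi_translate x y a : pi x = pi y -> pi (x * a)%g = pi (y * a)%g.
Proof.
by move=> /pi_fibre xy; apply/pi_fibre; rewrite invgM mulgA mulgK.
Qed.

Fact pullback_subproof f : f \o pi \in smooth_fun G.
Proof.
apply/smooth_funP => x; have [_ _ [spi _]] := quo.
by apply: (smooth_at_comp_map openT _ spi) => //; exact: Cinfty_smooth_at.
Qed.

Definition pullback f : Cinfty G := SmoothFun (pullback_subproof f).

Lemma pullbackE f x : pullback f x = f (pi x). Proof. by []. Qed.

Lemma pi_relatedP X (Y : vfield M) :
  vf_related pi X Y <-> forall f x, X (pullback f) x = Y f (pi x).
Proof.
split=> [rXY f x|rXY f h hE]; first by rewrite (rXY f (pullback f) erefl).
by apply/funext => x; rewrite (_ : h = pullback f) ?rXY//; exact: Cinfty_eq.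
Qed.

Lemma pi_related_unique X (Y Y' : vfield M) :
  vf_related pi X Y -> vf_related pi X Y' -> Y = Y'.
Proof.
move=> /pi_relatedP rY /pi_relatedP rY'; apply: vfield_eq => f.
apply/Cinfty_eq/funext => q; have [x <-] := pi_surj q.
by rewrite -rY -rY'.
Qed.

Lemma pullback_vfield X (Y : vfield M) f : vf_related pi X Y ->
  X (pullback f) = pullback (Y f).
Proof. by move=> /pi_relatedP r; apply/Cinfty_eq/funext => x; rewrite r. Qed.

(** Near any point the descended function is [h] composed with a local inverse of
    [pi]. *)
Lemma descend_fun (h : Cinfty G) : (forall x y, pi x = pi y -> h x = h y) ->
  exists f : Cinfty M, forall x, f (pi x) = h x.
Proof.
move=> hinv; have [r rP] := choice pi_surj.
have hr x : h (r (pi x)) = h x by apply: hinv; rewrite rP.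
suff sf : h \o r \in smooth_fun M by exists (SmoothFun sf).
apply/smooth_funP => q; have [x xq] := pi_surj q.
have [_ _ [_ /(_ x)[U [V [s [[oU oV] Ux UV VU sV]]]]]] := quo.
have Vq : V q by rewrite -xq; have [] := UV x Ux.
apply: (@smooth_at_ext _ _ _ (h \o s)); last first.
  by apply: smooth_at_comp_map oV Vq sV _; exact: Cinfty_smooth_at.
have : nbhs q V by exact: open_nbhs_nbhs.
apply: filterS => q' Vq' /=; have [_ psq] := VU q' Vq'.
by rewrite -[q' in RHS]psq hr.
Qed.

(** Two points of a fibre of [pi] differ by a left translation that leaves
    pulled back functions unchanged, hence also their derivatives under a
    left-invariant field. *)
Lemma left_invariant_descends X : left_invariant_vf X ->
  exists Y : vfield M, vf_related pi X Y.
Proof.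
move=> /left_invariantP lX.
have inv f x y : pi x = pi y -> X (pullback f) x = X (pullback f) y.
  move=> xy; have := xy => /pi_fibre Gg.
  have E : ltrans (y * x^-1)%g (pullback f) = pullback f.
    apply/Cinfty_eq/funext => z; rewrite ltransE !pullbackE; congr (f _).
    by apply/esym/pi_fibre; rewrite mulgK.
  by rewrite -{1}E lX ltransE mulgVK.
have [D DP] := choice (fun f => descend_fun (inv f)).
have Dder : (D : Cinfty M -> (Cinfty M)^o) \in is_derivation M.
  rewrite inE; split=> [a f h|f h]; apply/Cinfty_eq/funext => q;
    have [x <-] := pi_surj q.
    rewrite !CinftyE !DP (_ : pullback _ = a *: pullback f + pullback h).
      by rewrite vfieldZD !CinftyE.
    exact: Cinfty_eq.
  rewrite !CinftyE !DP (_ : pullback _ = pullback f * pullback h).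
    by rewrite vfieldM !CinftyE.
  exact: Cinfty_eq.
by exists (VField Dder); apply/pi_relatedP => f x; rewrite /= DP.
Qed.

(** The default value 0 is taken only if no field on [M] is related to [X]. *)
Definition descend X : vfield M := xget 0 [set Y : vfield M | vf_related pi X Y].

Lemma descendP X : left_invariant_vf X -> vf_related pi X (descend X).
Proof.
by move=> /left_invariant_descends[Y rY]; rewrite /descend; case: xgetP => // /(_ Y).
Qed.

Lemma descendE X f x : left_invariant_vf X -> descend X f (pi x) = X (pullback f) x.
Proof. by move=> /descendP/pi_relatedP ->. Qed.

Lemma descend_eq X (Y : vfield M) : left_invariant_vf X -> vf_related pi X Y ->
  descend X = Y.
Proof. by move=> lX; apply: pi_related_unique; exact: descendP. Qed.

(** By left translation, a nonzero left-invariant field vanishes nowhere; a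
    function on [G] detecting this near one point of the fibre is
    moved to [M] by a local inverse of [pi] and a cut-off. *)
Lemma descend_neq0 X q : left_invariant_vf X -> X <> 0 ->
  exists h : Cinfty M, descend X h q != 0.
Proof.
move=> lX X0.
have [f0 [x0 Xfx]] : exists (f : Cinfty G) (x : G), X f x != 0.
  apply: contrapT => H; apply: X0; apply: vfield_eq => f.
  apply/Cinfty_eq/funext => x; apply/eqP/negPn/negP => Xfx.
  by apply: H; exists f, x.
have [y yq] := pi_surj q.
(* A left translate of [f0], with the point [x0] moved to [y]. *)
pose F := ltrans (y^-1)%g (ltrans x0 f0).
have XF : X F y != 0.
  rewrite /F ((left_invariantP _).1 lX) ltransE mulVg -(left_invariant_at _ _ lX).
  exact: Xfx.
have [_ _ [_ /(_ y)[U [V [s [[oU oV] Uy UV VU sV]]]]]] := quo.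
have [Vy sy] := UV y Uy.
have [b [K [cK KV b0 bq]]] := smooth_bump oV Vy.
pose F1 : Cinfty G := F - F y *: (1 : Cinfty G).
have su q' : V q' -> smooth_at (F1 \o s) q'.
  by move=> Vq'; apply: smooth_at_comp_map oV Vq' sV _; exact: Cinfty_smooth_at.
pose h := SmoothFun (cutoff_smooth cK KV b0 su).
exists h; rewrite -yq descendE//.
have -> : X (pullback h) y = X (pullback b * F1) y.
  apply: vfield_local; have : nbhs y U by exact: open_nbhs_nbhs.
  apply: filterS => x Ux; rewrite pullbackE CinftyE pullbackE.
  by rewrite -[LHS]/(b (pi x) * F1 (s (pi x))); have [_ ->] := UV x Ux.
rewrite vfieldM !CinftyE pullbackE /F1 vfieldB vfieldZ vfield1 !CinftyE.
by rewrite mulr1 subrr mulr0 add0r mulr0 subr0 mulf_neq0.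
Qed.

End Quotient.

(** * Divergences on a compact quotient *)

Section CompactQuotient.
Variables (R : realType) (n : nat) (G : lieGroupType R n) (Gamma : set G).
Variables (M : manifoldType R n) (pi : G -> M).
Hypothesis quo : is_left_quotient Gamma pi.
Hypothesis cM : compact [set: M].
Implicit Types (X Y : vfield G) (f u : Cinfty M) (x y a : G) (q : M).
Notation pullback := (pullback quo).
Notation descend := (descend pi).

Lemma Cinfty_continuous f : continuous f.
Proof. by move=> q; apply: smooth_at_continuous; exact: Cinfty_smooth_at. Qed.

Lemma Cinfty_bounded f : exists C, forall q, `|f q| <= C.
Proof.
have M0 : [set: M] !=set0 by exists (pi 1%g).
have cf : {within [set: M], continuous (fun q => `|f q|)}.
  apply: continuous_subspaceT => q; apply: continuous_comp; first exact: Cinfty_continuous.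
  exact: norm_continuous.
have [q _ qP] := compact_EVT_max M0 cM cf.
by exists `|f q| => q'; apply: qP; rewrite inE.
Qed.

Lemma Cinfty_min f : exists q, forall q', f q <= f q'.
Proof.
have M0 : [set: M] !=set0 by exists (pi 1%g).
have cf : {within [set: M], continuous f}.
  by apply: continuous_subspaceT; exact: Cinfty_continuous.
have [q _ qP] := compact_EVT_min M0 cM cf.
by exists q => q'; apply: qP; rewrite inE.
Qed.

(** In a chart at the identity let [al] be the line through the identity with
    the direction of [X]. The left-invariance of [X] makes [t * X f] the linear
    part of [t |-> f (x (al t))] for every [x], and [strictly_differentiable]
    makes the error uniform near a point. The estimate depends on [x] only
    through [pi x]. *)
Lemma difference_quotient_near X f (e : R) : left_invariant_vf X -> 0 < e ->
  exists al : R -> G, forall q, \forall q' \near q & t \near 0^'+,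
    forall x, pi x = q' ->
     `|f (pi (x * al t)%g) - f (pi x) - t * descend X f (pi x)| <= t * e.
Proof.
move=> lX e0.
have [c ac c1] := atlas_cover (1%g : G); have hc := atlas_chart _ ac.
have [v vP] := vfield_derive X ac c1.
exists (fun t => chart_inv c (t *: v + c 1%g)) => q.
have [y <-] := pi_surj quo q.
have [d ad dy] := atlas_cover y; have hd := atlas_chart _ ad.
pose F := mul_in_charts (pullback f) d c.
have [W [oW W0 CW]] := mul_in_charts_smooth ad ac dy c1 (Cinfty_smooth_at (pullback f) (y * 1)%g) 1.
pose V0 := row_mx (0 : 'rV[R]_n) v.
have N0 : 0 < `|V0| + 1 by rewrite ltr_wpDl.
have e'0 : 0 < e / (`|V0| + 1) by rewrite divr_gt0.
have [r r0 rP] := strictly_differentiable oW W0 CW e'0.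
rewrite -/F in CW rP.
have [_ _ [_ /(_ y)[U [V [s [[oU oV] Uy UV VU [cs _]]]]]]] := quo.
have [Vy sy] := UV y Uy.
pose P w := W (row_mx w (c 1%g)) /\ `|row_mx (d y) (c 1%g) - row_mx w (c 1%g)| < r.
have near0 : nbhs (d y) P.
  have cr (w : 'rV[R]_n) : {for w, continuous (fun w : 'rV[R]_n => row_mx w (c 1%g))}.
    by apply: (Ck_row_mxl 0 (c 1%g) openT w I).
  pose B := W `&` ball (row_mx (d y) (c 1%g)) r.
  have oB : open B by apply: openI => //; exact: ball_open.
  have -> : P = (fun w : 'rV[R]_n => row_mx w (c 1%g)) @^-1` B.
    by apply/funext => w; rewrite /P /B /= -ball_normE.
  apply: open_nbhs_nbhs; split; first by apply: open_comp => // w _; exact: cr.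
  by split=> //; exact: ballxx.
have neary : nbhs y (chart_dom d `&` d @^-1` P).
  have [oD _ _ cD _] := hd; apply: filterI; first exact: open_nbhs_nbhs.
  by apply: cD.
have nears : nbhs (pi y) (V `&` s @^-1` (chart_dom d `&` d @^-1` P)).
  apply: filterI; first exact: open_nbhs_nbhs.
  by apply: (cs _ Vy); rewrite sy.
have neart : \forall t \near 0^'+, 0 <= t /\ t * `|V0| < r.
  near=> t.
  have t0 : 0 < t by near: t; exact: nbhs_right_gt.
  split; first exact: ltW.
  have tsmall : t < r / (`|V0| + 1) by near: t; apply: nbhs_right_lt; rewrite divr_gt0.
  move: tsmall; rewrite ltr_pdivlMr//; apply: le_lt_trans.
  by rewrite ler_pM2l// lerDl.
exists (V `&` s @^-1` (chart_dom d `&` d @^-1` P), [set t | 0 <= t /\ t * `|V0| < r]).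
  by split.
move=> [q' t] /= [[Vq' [dq' [Wq' rq']]] [t0 tsmall]] x xq'.
have [_ psq'] := VU q' Vq'.
have xs : pi x = pi (s q') by rewrite psq'.
rewrite (pi_translate quo _ xs) xs.
have lr : `|t *: V0| < r by rewrite normrZ ger0_norm.
have := rP (row_mx (d (s q')) (c 1%g)) (t *: V0) rq' lr.
have dF : differentiable F (row_mx (d (s q')) (c 1%g)) by have [dF _] := CW; exact: dF.
have -> : 'D_(t *: V0) F (row_mx (d (s q')) (c 1%g)) = t * descend X f (pi (s q')).
  rewrite deriveE// linearZ /= -deriveE//; congr (_ * _).
  rewrite (descendE quo f _ lX) (left_invariant_at _ _ lX) vP -derive_row_mxr.
  congr ('D_v _ (c 1%g)); apply/funext => w.
  by rewrite /F /mul_in_charts /= row_mxKl row_mxKr chart_cancel.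
have -> : F (t *: V0 + row_mx (d (s q')) (c 1%g)) = f (pi (s q' * chart_inv c (t *: v + c 1%g))%g).
  rewrite /V0 scale_row_mx scaler0 add_row_mx add0r.
  by rewrite /F /mul_in_charts /= row_mxKl row_mxKr chart_cancel.
have -> : F (row_mx (d (s q')) (c 1%g)) = f (pi (s q')).
  by rewrite /F /mul_in_charts /= row_mxKl row_mxKr !chart_cancel// mulg1.
move=> /le_trans; apply.
rewrite normrZ (ger0_norm t0) mulrCA ler_wpM2l// -mulrA ler_piMr ?(ltW e0)//.
by rewrite mulrC ler_pdivrMr// mul1r lerDl.
Unshelve. all: by end_near. Qed.

Lemma difference_quotient X f (e : R) : left_invariant_vf X -> 0 < e ->
  exists (a : G) (t : R), 0 < t /\ forall x,
    t * (descend X f (pi x) - e) <= f (pi (x * a)%g) - f (pi x).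
Proof.
move=> lX e0; have [al alP] := difference_quotient_near f lX e0.
have H := (compact_near_coveringP _).1 cM _ 0^'+ (fun t q' => forall x, pi x = q' ->
     `|f (pi (x * al t)%g) - f (pi x) - t * descend X f (pi x)| <= t * e) _ (fun q _ => alP q).
have /filter_ex[t [t0 tP]] : \forall t \near 0^'+, 0 < t /\ forall x,
    `|f (pi (x * al t)%g) - f (pi x) - t * descend X f (pi x)| <= t * e.
  near=> t; split=> //.
  have : (fun t => [set: M] `<=` (fun q' => forall x, pi x = q' ->
     `|f (pi (x * al t)%g) - f (pi x) - t * descend X f (pi x)| <= t * e)) t by near: t; exact: H.
  by move=> tP x; exact: (tP (pi x) I x erefl).
exists (al t), t; split=> // x.
have := tP x; rewrite ler_norml => /andP[+ _].
by rewrite mulrBr; lra.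
Unshelve. all: by end_near. Qed.

(** Such functions have mean value zero for an invariant measure, and the set of
    all of them stands for the kernel of the average in what follows. *)
Inductive divergence : Cinfty M -> Prop :=
| Divergence0 : divergence 0
| DivergenceS X f u : left_invariant_vf X -> divergence u -> divergence (descend X f + u).

Lemma divergence_coboundary u (e : R) : divergence u -> 0 < e ->
  exists m w, coboundary m w /\ forall x, u (pi x) - e <= w x.
Proof.
move=> du; elim: du e => [|X f {}u lX _ IH] e e0.
  exists 0, (fun=> 0); split; first exact: Coboundary0 (CentralCoboundary0 _ _).
  by move=> x; rewrite CinftyE; lra.
have e2 : 0 < e / 2 by rewrite divr_gt0.
have [m [w [wm wP]]] := IH _ e2.
have [a [t [t0 tP]]] := difference_quotient f lX e2.
have bF : bounded_fct (fun x => t^-1 * f (pi x)).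
  have [C CP] := Cinfty_bounded f; exists (t^-1 * C) => x.
  by rewrite normrM gtr0_norm ?invr_gt0// ler_wpM2l// invr_ge0 ltW.
exists m.+1, (fun x => t^-1 * f (pi (x * a)%g) - t^-1 * f (pi x) + w x); split.
  exact: CoboundaryS.
move=> x; rewrite CinftyE.
have : descend X f (pi x) - e / 2 <= t^-1 * f (pi (x * a)%g) - t^-1 * f (pi x).
  by rewrite -mulrBr ler_pdivlMl.
have := wP x; lra.
Qed.

Theorem divergence_not_gt0 u : (forall x y z : G, commute (commg x y) z) ->
  divergence u -> ~ forall q, 0 < u q.
Proof.
move=> nil2 du u0; have [q0 q0P] := Cinfty_min u.
have d2 : 0 < u q0 / 2 by rewrite divr_gt0.
have [m [w [wm wP]]] := divergence_coboundary du d2.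
apply: (coboundary_not_ge nil2 wm d2) => x.
by have := wP x; have := q0P (pi x); lra.
Qed.

End CompactQuotient.

(** * HKT metrics and two-step nilpotent Lie algebras *)

Section QuaternionicAlgebra.
Variables (V E : zmodType) (br : V -> V -> V) (I J K : V -> V).
Variables (q : V -> V -> E) (D : E -> Prop).

(** With [q] a metric, this is up to sign J dF evaluated on left-invariant
    fields, for an invariant metric. *)
Definition cyclic_sum (A : V -> V) X Y Z : E :=
  q (br (A X) (A Y)) Z + q (br (A Y) (A Z)) X + q (br (A Z) (A X)) Y.

Definition nijenhuis_free (A : V -> V) := forall X Y,
  br (A X) (A Y) - A (br (A X) Y) - A (br X (A Y)) - br X Y = 0.

Definition almost_complex (A : V -> V) := (forall X Y, A (X + Y) = A X + A Y) /\ forall X, A (A X) = - X.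

Hypotheses (brD : forall X Y Z, br (X + Y) Z = br X Z + br Y Z)
  (brC : forall X Y, br Y X = - br X Y)
  (br_nil : forall X Y Z, br (br X Y) Z = 0).
Hypotheses (cI : almost_complex I) (cJ : almost_complex J) (cK : almost_complex K).
Hypotheses (IJ : forall X, I (J X) = K X) (JI : forall X, J (I X) = - K X).
Hypotheses (NI : nijenhuis_free I) (NJ : nijenhuis_free J) (NK : nijenhuis_free K).
Hypothesis qD : forall X Y Z, q (X + Y) Z = q X Z + q Y Z.
Hypotheses (D0 : D 0) (DB : forall u v, D u -> D v -> D (u - v))
  (Dq : forall X, D (q X X) -> X = 0).
Hypotheses (SJ : forall X Y Z, D (cyclic_sum I X Y Z - cyclic_sum J X Y Z))
  (SK : forall X Y Z, D (cyclic_sum I X Y Z - cyclic_sum K X Y Z)).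

Let add0 (A : V -> V) : (forall X Y, A (X + Y) = A X + A Y) -> A 0 = 0.
Proof. by move=> AD; apply: (addrI (A 0)); rewrite -AD !addr0. Qed.

Let addN (A : V -> V) : (forall X Y, A (X + Y) = A X + A Y) -> forall X, A (- X) = - A X.
Proof. by move=> AD X; apply: (addrI (A X)); rewrite -AD !subrr add0. Qed.

Let br0 X : br 0 X = 0. Proof. by apply: (addrI (br 0 X)); rewrite -brD !addr0. Qed.
Let brN X Y : br (- X) Y = - br X Y.
Proof. by apply: (addrI (br X Y)); rewrite -brD !subrr br0. Qed.
Let brrN X Y : br X (- Y) = - br X Y. Proof. by rewrite brC brN opprK brC. Qed.
Let q0 X : q 0 X = 0. Proof. by apply: (addrI (q 0 X)); rewrite -qD !addr0. Qed.
Let qN X Y : q (- X) Y = - q X Y.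
Proof. by apply: (addrI (q X Y)); rewrite -qD !subrr q0. Qed.
Let central Z := forall X, br Z X = 0.

Let centralr Z X : central Z -> br X Z = 0.
Proof. by move=> cZ; rewrite brC cZ oppr0. Qed.

Let bracket_of_central (A : V -> V) Z X : nijenhuis_free A -> almost_complex A ->
  central Z -> br (A Z) (A X) = A (br (A Z) X).
Proof.
move=> NA [AD AA] cZ; have /eqP := NA Z X.
by rewrite !cZ (add0 AD) !subr0 subr_eq0 => /eqP.
Qed.

Let JK X : J (K X) = I X.
Proof.
have [ID II] := cI; have [JD JJ] := cJ.
by rewrite -IJ JI -IJ JJ (addN ID) opprK.
Qed.

Let KI X : K (I X) = J X.
Proof. by have [ID II] := cI; rewrite -IJ JI (addN ID) -IJ II opprK. Qed.

(** Here [B] is [J] or [K] and [v := br (B A) W]. As [v], [I v], [B v], [I A] are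
    central, the cyclic sums at [(v, - B W, A)] reduce to 0 for [I], and to
    [- q v v] for [B]. *)
Let central_rotate (B : V -> V) A : almost_complex B ->
  (forall X Y Z, D (cyclic_sum I X Y Z - cyclic_sum B X Y Z)) ->
  central A -> central (I A) ->
  (forall W, br (B A) (J W) = J (br (B A) W)) ->
  (forall W, br (B A) (K W) = K (br (B A) W)) ->
  (B = J \/ B = K) -> central (B A).
Proof.
move=> [BD BB] SB cA cIA BJ BK BJK W; set v := br (B A) W.
have cv : central v by exact: br_nil.
have cJv : central (J v) by rewrite /v -BJ; exact: br_nil.
have cKv : central (K v) by rewrite /v -BK; exact: br_nil.
have cIv : central (I v) by rewrite -JK /v -BK -BJ; exact: br_nil.
have cBv : central (B v) by case: BJK => ->.
apply: Dq; have := SB v (- B W) A; rewrite /cyclic_sum !cIv (centralr _ cIA) (centralr _ cIv).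
rewrite !cBv (centralr _ cBv) !q0 !addr0 !add0r (addN BD) BB opprK.
by rewrite (brC (B A) W) -/v qN opprK.
Qed.

(** The algebraic core. [D] is the set of divergences, and [Dq] says that [q] is
    positive definite modulo divergences. *)
Lemma abelian_of_cyclic X Y : br (I X) (I Y) = br X Y.
Proof.
have [[ID II] [JD JJ] [KD KK]] := And3 cI cJ cK.
pose A := br X Y - br (I X) (I Y).
have cA : central A by move=> W; rewrite /A brD brN !br_nil subrr.
have IA : I A = br (I X) Y + br X (I Y).
  have := NI X Y; rewrite /A => /eqP.
  rewrite subr_eq0 -addrA -opprD -ID => /eqP <-.
  by rewrite addrAC subrr sub0r (addN ID) II opprK.
have cIA : central (I A) by move=> W; rewrite IA brD !br_nil addr0.
have cJA : central (J A).
  apply: central_rotate => //; last by left.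
    by move=> W; exact: bracket_of_central.
  by move=> W; have := bracket_of_central W NK cK cIA; rewrite KI.
have cKA : central (K A).
  apply: central_rotate => //; last by right.
    move=> W; have := bracket_of_central W NJ cJ cIA.
    by rewrite JI !brN (addN JD) => /oppr_inj.
  by move=> W; exact: bracket_of_central.
have S2 (B : V -> V) U W : central (B A) -> cyclic_sum B U W A = q (br (B U) (B W)) A.
  by move=> cBA; rewrite /cyclic_sum cBA (centralr _ cBA) !q0 !addr0.
(* [J I = - K], so the second comparison also involves [K X] and [K Y]. *)
have H1 := SK X Y A; have H2 := SJ (I X) (I Y) A.
move: H1 H2; rewrite !S2// !JI !II !brN !brrN !opprK => H1 H2.
suff : A = 0 by move/eqP; rewrite subr_eq0 => /eqP.
apply: Dq; rewrite {1}/A qD qN.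
have := DB H2 H1; rewrite opprB addrA subrK; exact.
Qed.

End QuaternionicAlgebra.

Section HKTIdentity.
Variables (R : realType) (n : nat) (M : manifoldType R n).
Variables (g : metric M) (K : {linear vfield M -> vfield M}).
Variable nabla : vfield M -> vfield M -> vfield M.
Implicit Types X Y Z U W : vfield M.

Lemma metricDl X Y Z : g (X + Y) Z = g X Z + g Y Z.
Proof. by have := metric_linear g 1 X Y Z; rewrite scale1r mul1r. Qed.

Lemma metricDr X Y Z : g Z (X + Y) = g Z X + g Z Y.
Proof. by rewrite metricC metricDl !(metricC g Z). Qed.

Lemma metricNl X Y : g (- X) Y = - g X Y.
Proof.
have g0 : g 0 Y = 0 by apply: (addrI (g 0 Y)); rewrite -metricDl !addr0.
by apply: (addrI (g X Y)); rewrite -metricDl !subrr.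
Qed.

Lemma metricNr X Y : g Y (- X) = - g Y X.
Proof. by rewrite metricC metricNl metricC. Qed.

Hypothesis herm : forall X Y, g (K X) (K Y) = g X Y.
Hypothesis conn : is_connection nabla.
Hypothesis nablag : forall X Y Z, X (g Y Z) = g (nabla X Y) Z + g Y (nabla X Z).
Hypothesis nablaK : forall X Y, nabla X (K Y) = K (nabla X Y).
Notation T := (torsion nabla).
Hypothesis skew : totally_skew (fun X Y Z => g X (T Y Z)).

Let nabla_r0 X : nabla X 0 = 0.
Proof. by have [_ nD _] := conn; apply: (addrI (nabla X 0)); rewrite -nD !addr0. Qed.

Let nablaN X Y : nabla X (- Y) = - nabla X Y.
Proof.
have [_ nD _] := conn; apply: (addrI (nabla X Y)).
by rewrite -nD !subrr nabla_r0.
Qed.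

Let nablaKK X Y : K (K Y) = - Y -> K (K (nabla X Y)) = - nabla X Y.
Proof. by move=> KY; rewrite -!nablaK KY nablaN. Qed.

Let hermN X Y : K (K Y) = - Y -> g (K X) Y = - g X (K Y).
Proof. by move=> KY; rewrite -(herm X (K Y)) KY metricNr opprK. Qed.

(** The Nijenhuis tensor of [K], written with a connection that preserves [K],
    involves only the torsion. *)
Lemma torsion_integrable X Y :
  K (K X) = - X -> K (K Y) = - Y ->
  lie_bracket (K X) (K Y) - K (lie_bracket (K X) Y)
    - K (lie_bracket X (K Y)) - lie_bracket X Y = 0 ->
  T (K X) (K Y) = K (T (K X) Y) + K (T X (K Y)) + T X Y.
Proof.
move=> KX KY /eqP; rewrite subr_eq0 subr_eq subr_eq => /eqP N.
rewrite /torsion N !linearB /= !nablaK !nablaKK//.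
by apply: vfield_eq => f; rewrite !(vfield_addE, vfield_oppE); ring.
Qed.

(** The 3-form [c] satisfies [c(X,Y,Z) = c(KX,KY,Z) + c(KX,Y,KZ) + c(X,KY,KZ)],
    i.e. it has no components of type (3,0) and (0,3). *)
Lemma torsion_cyclic X Y Z :
  K (K X) = - X -> K (K Y) = - Y -> K (K Z) = - Z ->
  T (K X) (K Y) = K (T (K X) Y) + K (T X (K Y)) + T X Y ->
  g Z (T (K X) (K Y)) + g X (T (K Y) (K Z)) + g Y (T (K Z) (K X)) = g X (T Y Z).
Proof.
move=> KX KY KZ N.
have gK U : g Z (K U) = - g (K Z) U.
  by rewrite metricC (hermN U KZ) metricC.
have rot U W S : g U (T W S) = g W (T S U).
  have [_ ->] := skew W U S; have [-> _] := skew U W S.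
  by rewrite opprK.
rewrite N 2![g Z (_ + _)]metricDr !gK (rot (K Z) (K X) Y) (rot (K X) Y (K Z)).
by rewrite (rot (K Z) X (K Y)) (rot Z X Y); ring.
Qed.

(** Expanding the derivatives with the metric connection, the covariant
    derivatives cancel in pairs and the torsion remains. *)
Lemma torsion_form X Y Z :
  K (K X) = - X -> K (K Y) = - Y -> K (K Z) = - Z ->
  (K X) (g Y (K Z)) + (K Y) (g Z (K X)) + (K Z) (g X (K Y)) +
    (g (lie_bracket (K X) (K Y)) Z + g (lie_bracket (K Y) (K Z)) X +
     g (lie_bracket (K Z) (K X)) Y) =
  - (g Z (T (K X) (K Y)) + g X (T (K Y) (K Z)) + g Y (T (K Z) (K X))).
Proof.
move=> KX KY KZ.
have key U Y' Z' : K (K Y') = - Y' -> K (K Z') = - Z' ->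
  (K U) (g Y' (K Z')) = g (nabla (K U) Y') (K Z') - g (nabla (K U) Z') (K Y').
  move=> KY' KZ'; rewrite nablag nablaK; congr (_ + _).
  by rewrite metricC (hermN _ KY').
rewrite !key//.
have brE U W Z' : K (K Z') = - Z' -> g (lie_bracket (K U) (K W)) Z' =
   - g Z' (T (K U) (K W)) - g (nabla (K U) W) (K Z') + g (nabla (K W) U) (K Z').
  move=> KZ'; rewrite /torsion !metricDr !metricNr !nablaK.
  rewrite !(metricC g Z' (K _)) !(hermN _ KZ') (metricC g Z').
  by ring.
rewrite !brE//.
ring.
Qed.

End HKTIdentity.

(** * Non-existence of HKT metrics *)

Section LieAlgebra.
Variables (R : realType) (n : nat) (G : lieGroupType R n).

Definition left_invariant_pred : {pred vfield G} :=
  mem [set X : vfield G | left_invariant_vf X].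

Fact left_invariant_zmod_closed : zmod_closed left_invariant_pred.
Proof.
split; first by rewrite inE; apply/left_invariantP => a f; exact/Cinfty_eq.
move=> X Y; rewrite !inE => /left_invariantP lX /left_invariantP lY.
apply/left_invariantP => a f.
by rewrite !vfield_addE !vfield_oppE lX lY; exact/Cinfty_eq.
Qed.

HB.instance Definition _ := GRing.isZmodClosed.Build (vfield G)
  left_invariant_pred left_invariant_zmod_closed.

(** The left-invariant fields, as a type, so that brackets and complex structures
    are total operations on it. *)
Record lie_algebra := LieAlgebra {
  lie_vf :> vfield G;
  lie_vfP : lie_vf \in left_invariant_pred }.

HB.instance Definition _ := [isSub for lie_vf].
HB.instance Definition _ := [Choice of lie_algebra by <:].
HB.instance Definition _ := [SubChoice_isSubZmodule of lie_algebra by <:].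

Lemma lie_invariant (X : lie_algebra) : left_invariant_vf X.
Proof. exact: set_mem (lie_vfP X). Qed.

Lemma lie_eq (X Y : lie_algebra) : X = Y :> vfield G -> X = Y.
Proof. exact: val_inj. Qed.

Definition lie_br (X Y : lie_algebra) : lie_algebra :=
  LieAlgebra (mem_set (left_invariant_bracket (lie_invariant X) (lie_invariant Y))).

Lemma lie_tensor_subproof (J : {linear vfield G -> vfield G}) (lJ : left_invariant J)
  (X : lie_algebra) : J X \in left_invariant_pred.
Proof. by apply: mem_set => a; apply: lJ; exact: lie_invariant. Qed.

Definition lie_tensor (J : {linear vfield G -> vfield G}) (lJ : left_invariant J) (X : lie_algebra) : lie_algebra :=
  LieAlgebra (lie_tensor_subproof lJ X).

End LieAlgebra.

Section Main.
Variables (R : realType) (n : nat) (G : lieGroupType R n)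
    (J : 'I_3 -> {linear vfield G -> vfield G})
    (Gamma : set G) (M : manifoldType R n) (pi : G -> M)
    (K : 'I_3 -> {linear vfield M -> vfield M}).
Hypotheses (nilG : two_step_nilpotent G) (hJ : hypercomplex J)
  (lJ : forall i, left_invariant (J i)) (quo : is_left_quotient Gamma pi)
  (cM : compact [set: M]) (JK : forall i, tensor_related pi (J i) (K i)).
Variable g : metric M.
Hypothesis hkt : HKT K g.

Notation L := (lie_algebra G).
Let ds (X : L) : vfield M := descend pi X.
Let A i (X : L) : L := lie_tensor (lJ i) X.
Let q (X Y : L) : Cinfty M := g (ds X) (ds Y).
Notation D := (divergence pi).

Let dsP (X : L) : vf_related pi X (ds X).
Proof. exact: (descendP quo (lie_invariant X)). Qed.

Let ds_eq (X : L) Y : vf_related pi X Y -> ds X = Y.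
Proof. exact: (descend_eq quo (lie_invariant X)). Qed.

Let dsD (X Y : L) : ds (X + Y) = ds X + ds Y.
Proof.
apply: ds_eq; apply/(pi_relatedP quo) => f x.
by rewrite !vfield_addE !CinftyE -!((pi_relatedP quo _ _).1 (dsP _)).
Qed.

Let ds_br (X Y : L) : ds (lie_br X Y) = lie_bracket (ds X) (ds Y).
Proof.
apply: ds_eq; apply/(pi_relatedP quo) => f x.
rewrite !lie_bracketE !CinftyE -!((pi_relatedP quo _ _).1 (dsP _)).
by rewrite -!(pullback_vfield quo _ (dsP _)).
Qed.

Let ds_tensor i (X : L) : ds (A i X) = K i (ds X).
Proof. by apply: ds_eq; apply: JK; exact: dsP. Qed.

Let KK i (X : L) : K i (K i (ds X)) = - ds X.
Proof.
have [/(_ i)[JJ _] _] := hJ.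
rewrite -!ds_tensor; apply: ds_eq; rewrite /= JJ.
apply/(pi_relatedP quo) => f x.
by rewrite !vfield_oppE !CinftyE -((pi_relatedP quo _ _).1 (dsP _)).
Qed.

Let Nijenhuis i (X Y : L) :
  lie_bracket (K i (ds X)) (K i (ds Y)) - K i (lie_bracket (K i (ds X)) (ds Y))
    - K i (lie_bracket (ds X) (K i (ds Y))) - lie_bracket (ds X) (ds Y) = 0.
Proof.
have ds0 : ds 0 = 0 by apply: (addrI (ds 0)); rewrite -dsD !addr0.
have dsN Z : ds (- Z) = - ds Z.
  by apply: (addrI (ds Z)); rewrite -dsD !subrr ds0.
rewrite -!ds_tensor -!ds_br -!ds_tensor -!dsN -!dsD.
rewrite [X in ds X](_ : _ = 0)//; apply: lie_eq.
by have [/(_ i)[_ NJ] _] := hJ; exact: NJ.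
Qed.

Let D_add u v : D u -> D v -> D (u + v).
Proof.
move=> + dv; elim=> [|X f {}u lX _ IH]; first by rewrite add0r.
by rewrite -addrA; exact: DivergenceS.
Qed.

Let D_opp u : D u -> D (- u).
Proof.
elim=> [|X f {}u lX _ IH]; first by rewrite oppr0; exact: Divergence0.
by rewrite opprD -vfieldN; exact: DivergenceS.
Qed.

Let D_ds (X : L) f : D (ds X f).
Proof. by rewrite -[ds X f]addr0; apply: DivergenceS; [exact: lie_invariant|exact: Divergence0]. Qed.

Let q_definite (X : L) : D (q X X) -> X = 0.
Proof.
move=> dX; apply: contrapT => X0.
have [nil2 _] := nilG.
apply: (divergence_not_gt0 quo cM nil2 dX) => p; apply: metric_gt0.
apply: (descend_neq0 quo p (lie_invariant X)) => E.
by apply: X0; exact: lie_eq.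
Qed.

Let cyclic_sum_indep i j (X Y Z : L) :
  D (cyclic_sum (@lie_br _ _ G) q (A i) X Y Z - cyclic_sum (@lie_br _ _ G) q (A j) X Y Z).
Proof.
have [herm [nabla [conn ng nK skew]]] := hkt.
pose der k := (K k (ds X)) (g (ds Y) (K k (ds Z))) +
  (K k (ds Y)) (g (ds Z) (K k (ds X))) + (K k (ds Z)) (g (ds X) (K k (ds Y))).
have E k : der k + cyclic_sum (@lie_br _ _ G) q (A k) X Y Z = - g (ds X) (torsion nabla (ds Y) (ds Z)).
  rewrite /cyclic_sum /q !ds_br !ds_tensor.
  rewrite (torsion_form (herm k) ng (nK k) (KK k X) (KK k Y) (KK k Z)).
  rewrite (torsion_cyclic (herm k) skew (KK k X) (KK k Y) (KK k Z))//; last first.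
  exact: (torsion_integrable conn (nK k) (KK k X) (KK k Y) (Nijenhuis k X Y)).
have Dd k : D (der k) by rewrite /der -!ds_tensor; apply: D_add; [apply: D_add|]; exact: D_ds.
have -> : cyclic_sum (@lie_br _ _ G) q (A i) X Y Z - cyclic_sum (@lie_br _ _ G) q (A j) X Y Z = der j - der i.
  apply/eqP; rewrite subr_eq addrAC eq_sym subr_eq.
  by rewrite (E j) addrC E.
by apply: D_add => //; exact: D_opp.
Qed.

(** Stated for an arbitrary quaternionic triple of indices, because the three
    complex structures are treated by cyclic permutation. *)
Lemma HKT_abelian_one i j k (X Y : L) :
  (forall X : vfield G, J i (J j X) = J k X) -> (forall X : vfield G, J j (J i X) = - J k X) ->
  lie_br (A i X) (A i Y) = lie_br X Y.
Proof.
have [nil2 _] := nilG; have [cJ _] := hJ => Jij Jji.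
have neg l : almost_complex (A l).
  split=> [U W|U]; apply: lie_eq => /=; first exact: linearD.
  by have [JJ _] := cJ l; exact: JJ.
have int l : nijenhuis_free (@lie_br _ _ G) (A l).
  by move=> U W; apply: lie_eq; have [_ NJ] := cJ l; exact: NJ.
apply: (@abelian_of_cyclic _ _ (@lie_br _ _ G) (A i) (A j) (A k) q D) => //.
- by move=> U W Z; apply: lie_eq; exact: lie_bracketDl.
- by move=> U W; apply: lie_eq; exact: lie_bracketC.
- move=> U W Z; apply: lie_eq; apply: bracket_central => //; exact: lie_invariant.
- by move=> U; apply: lie_eq; exact: Jij.
- by move=> U; apply: lie_eq; exact: Jji.
- by move=> U W Z; rewrite /q dsD metricDl.
- by move=> u v du dv; apply: D_add => //; exact: D_opp.
Qed.

Lemma HKT_abelian : abelian_hypercomplex J.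
Proof.
have [cJ J3] := hJ.
have J01 U : J 0 (J 1 U) = J 2%R U by have [] := J3 U.
have J10 U : J 1 (J 0 U) = - J 2%R U by have [E F] := J3 U; rewrite -F E opprK.
have JJ l U : J l (J l U) = - U by have [+ _] := cJ l; apply.
have J21 U : J 2%R (J 1 U) = - J 0 U by rewrite -J01 JJ linearN.
have J02 U : J 0 (J 2%R U) = - J 1 U by rewrite -J01 JJ.
have J12 U : J 1 (J 2%R U) = J 0 U by rewrite -J01 J10 J21 opprK.
have J20 U : J 2%R (J 0 U) = J 1 U by rewrite -J01 J10 linearN J02 opprK.
move=> i X Y lX lY.
pose X' : L := LieAlgebra (mem_set lX); pose Y' : L := LieAlgebra (mem_set lY).
suff E : lie_br (A i X') (A i Y') = lie_br X' Y' by exact: (congr1 (@lie_vf _ _ G) E).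
have [->|[->|->]] : i = 0 \/ i = 1 \/ i = 2%R.
  by case: i => [[|[|[|]]]] // ?; [left|right; left|right; right]; exact: val_inj.
- exact: HKT_abelian_one J01 J10.
- exact: HKT_abelian_one J12 J21.
- exact: HKT_abelian_one J20 J02.
Qed.

End Main.

Theorem theorem3p1 (R : realType) (n : nat) (G : lieGroupType R n)
    (J : 'I_3 -> {linear vfield G -> vfield G})
    (Gamma : set G) (M : manifoldType R n) (pi : G -> M)
    (K : 'I_3 -> {linear vfield M -> vfield M}) :
  two_step_nilpotent G ->
  hypercomplex J ->
  (forall i, left_invariant (J i)) ->
  ~ abelian_hypercomplex J ->
  discrete_subgroup Gamma ->
  is_left_quotient Gamma pi ->
  compact [set: M] ->
  (forall i, tensor_related pi (J i) (K i)) ->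
  ~ exists g : metric M, HKT K g.
Proof.
move=> nilG hJ lJ nabJ _ quo cM JK [g hkt]; apply: nabJ.
exact: (HKT_abelian nilG hJ lJ quo cM JK hkt).
Qed.
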